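(* Let $\mathcal{H}$ be a finite-dimensional Hilbert space and $U$ a unitary on $\mathcal{H}$. Let $|\phi^{\mathrm{in}}_1\rangle,\dots,|\phi^{\mathrm{in}}_K\rangle$ be unit vectors spanning a subspace $\mathcal{H}_{\mathrm{in}}$ of dimension $d$, such that the algebra generated by $\{|\phi^{\mathrm{in}}_k\rangle\langle\phi^{\mathrm{in}}_k|\}_{k=1}^K$ is the full matrix algebra of operators supported on $\mathcal{H}_{\mathrm{in}}$, and let $|\phi^{\mathrm{out}}_k\rangle=U|\phi^{\mathrm{in}}_k\rangle$. For a qubit $a$ define the controlled reflections $R^{\mathrm{in/out}}_a(k)=|0\rangle\langle0|_a\otimes I+|1\rangle\langle1|_a\otimes e^{i\pi|\phi^{\mathrm{in/out}}_k\rangle\langle\phi^{\mathrm{in/out}}_k|}$ and $W^{\mathrm{in/out}}_a(k)=R^{\mathrm{in/out}}_a(k)H_aR^{\mathrm{in/out}}_a(1)$, with $H_a$ the Hadamard gate on $a$. Consider the procedure: (i) choose $k_1,\dots,k_T$ independently and uniformly from $\{1,\dots,K\}$, prepare qubits $a_1,\dots,a_T$ in $|-\rangle$ and apply successively $W^{\mathrm{in}}_{a_1}(k_1),\dots,W^{\mathrm{in}}_{a_T}(k_T)$ (each to the system and the indicated qubit); (ii) prepare a qubit $c$ in $|-\rangle$, apply $R^{\mathrm{in}}_c(1)$, then a Hadamard on $c$, and measure $c$ in the computational basis; (iii) replace the system state by $|\phi^{\mathrm{out}}_1\rangle$; (iv) apply successively $W^{\mathrm{out}}_{a_T}(k_T)^\dagger,\dots,W^{\mathrm{out}}_{a_1}(k_1)^\dagger$.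 Let $\mathcal{E}_U$ be the channel describing its overall effect on the system when the measurement outcome is ignored. Let $\mathcal{D}(X)=K^{-1}\sum_{k=1}^Ke^{i\pi|\phi^{\mathrm{in}}_k\rangle\langle\phi^{\mathrm{in}}_k|}Xe^{i\pi|\phi^{\mathrm{in}}_k\rangle\langle\phi^{\mathrm{in}}_k|}$, regarded as a linear map on operators supported on $\mathcal{H}_{\mathrm{in}}$, and let $\lambda_{\mathcal{D}}$ be its eigenvalue of second largest magnitude. If $\epsilon_{\mathrm{id}}>0$ and $$T\ge\frac{d\,\log(8\epsilon_{\mathrm{id}}^{-2}d)}{1-|\lambda_{\mathcal{D}}|},$$ then for every state $\rho$ with support contained in $\mathcal{H}_{\mathrm{in}}$, $\|U\rho U^\dagger-\mathcal{E}_U(\rho)\|_1\le\epsilon_{\mathrm{id}}$.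
   Context: $\|\cdot\|_1$ is the trace norm (sum of singular values). $|\pm\rangle=(|0\rangle\pm|1\rangle)/\sqrt2$; the Hadamard gate maps $|0\rangle\mapsto|+\rangle$, $|1\rangle\mapsto|-\rangle$. $e^{i\pi|\phi\rangle\langle\phi|}=I-2|\phi\rangle\langle\phi|$. The controlled reflections are assumed to be implemented perfectly. $\log$ is the natural logarithm. *)

(* Defs.v *)
From HB Require Import structures.
From mathcomp Require Import all_boot all_order all_algebra complex.
From mathcomp Require Import reals exp.
Set Implicit Arguments. Unset Strict Implicit. Unset Printing Implicit Defensive.
Import Order.TTheory GRing.Theory Num.Theory.
Local Open Scope ring_scope.

Section QDefs.
Variable R : realType.
Local Notation C := R[i].

Definition adj m n (A : 'M[C]_(m, n)) : 'M[C]_(n, m) := (map_mx Num.conj A)^T.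

Definition psd n (A : 'M[C]_n) : Prop :=
  forall v : 'cV[C]_n, 0 <= (adj v *m A *m v) 0 0.

Definition is_state n (rho : 'M[C]_n) : Prop := psd rho /\ \tr rho = 1.

Definition ketbra n (v : 'cV[C]_n) : 'M[C]_n := v *m adj v.

(* e^{i pi |v><v|} = I - 2 |v><v| for a unit vector v (as in the context) *)
Definition refl n (v : 'cV[C]_n) : 'M[C]_n := 1%:M - 2%:R *: ketbra v.

Lemma spectrum_ex m (A : 'M[C]_m) :
  exists rs : seq C, char_poly A == \prod_(z <- rs) ('X - z%:P).
Proof.
have [rs Hrs] := closed_field_poly_normal (char_poly A).
exists rs; apply/eqP; rewrite {1}Hrs.
by have /monicP -> := char_poly_monic A; rewrite scale1r.
Qed.

Definition spectrum m (A : 'M[C]_m) : seq C := xchoose (spectrum_ex A).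

Definition trnorm m (A : 'M[C]_m) : C :=
  \sum_(z <- spectrum (adj A *m A)) sqrtC z.

(* Magnitude of the eigenvalue of second largest magnitude of a square
   matrix (eigenvalues counted with multiplicity); 0 if there is none. *)
Definition second_mag m (A : 'M[C]_m) : R :=
  complex.Re (nth 0 (sort (fun x y : C => y <= x) [seq `|z| | z <- spectrum A]) 1).

(* ---------- Joint system : system ('I_n) (x) qubits indexed by option 'I_T
   (Some t = ancilla a_{t+1}, None = the qubit c). ------------------------ *)
Section Joint.
Variables (n T : nat).
Definition JI := ('I_n * {ffun option 'I_T -> bool})%type.
Definition JOp := 'M[C]_#|{: JI}|.

Definition mkJ (f : JI -> JI -> C) : JOp :=
  \matrix_(i, j) f (enum_val i) (enum_val j).
Definition atJ (X : JOp) (x y : JI) : C := X (enum_rank x) (enum_rank y).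

(* Operator acting on qubit q and the system, given in block form
   A b b' = <b| A |b'> (an operator on the system), tensored with the
   identity on all other qubits. *)
Definition liftq (q : option 'I_T) (A : bool -> bool -> 'M[C]_n) : JOp :=
  mkJ (fun x y => (([forall s, (s != q) ==> (x.2 s == y.2 s)])%:R : C)
                   * A (x.2 q) (y.2 q) x.1 y.1).

Definition ctrlR (q : option 'I_T) (v : 'cV[C]_n) : JOp :=
  liftq q (fun b b' => if b == b' then (if b then refl v else 1%:M) else 0).

Definition hadJ (q : option 'I_T) : JOp :=
  liftq q (fun b b' => ((sqrtC 2)^-1 * (if b && b' then -1 else 1)) *: 1%:M).

Definition Wgate (q : option 'I_T) (vk v1 : 'cV[C]_n) : JOp :=
  ctrlR q vk *m hadJ q *m ctrlR q v1.

Definition minus_amp (b : bool) : C := (sqrtC 2)^-1 * (if b then -1 else 1).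
Definition init_state (rho : 'M[C]_n) : JOp :=
  mkJ (fun x y => rho x.1 y.1 * \prod_q minus_amp (x.2 q) * \prod_q minus_amp (y.2 q)).

Definition conjby (W X : JOp) : JOp := W *m X *m adj W.

(* computational basis measurement of qubit q, outcome ignored *)
Definition measure_q (q : option 'I_T) (X : JOp) : JOp :=
  mkJ (fun x y => ((x.2 q == y.2 q)%:R : C) * atJ X x y).

Definition replace_sys (v : 'cV[C]_n) (X : JOp) : JOp :=
  mkJ (fun x y => v x.1 0 * (v y.1 0)^* *
                  \sum_(j : 'I_n) atJ X (j, x.2) (j, y.2)).

Definition trace_qubits (X : JOp) : 'M[C]_n :=
  \matrix_(i, j) \sum_(b : {ffun option 'I_T -> bool}) atJ X (i, b) (j, b).

End Joint.

(* The channel E_U: average over k_1..k_T uniform in 'I_K (K >= 1 vectors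
   indexed by 'I_K, index ord0 playing the role of "1"). *)
Definition procedure_run n T K (phin phout : 'I_K -> 'cV[C]_n) (i0 : 'I_K)
    (ks : {ffun 'I_T -> 'I_K}) (rho : 'M[C]_n) : 'M[C]_n :=
  let Win := \big[(fun A B => B *m A)/1%:M]_(t < T)
               Wgate (Some t) (phin (ks t)) (phin i0) in
  let X1 := conjby Win (init_state T rho) in
  let X2 := measure_q None (conjby (hadJ n None) (conjby (ctrlR None (phin i0)) X1)) in
  let X3 := replace_sys (phout i0) X2 in
  let Wout := \big[(fun A B => A *m B)/1%:M]_(t < T)
               adj (Wgate (Some t) (phout (ks t)) (phout i0)) in
  trace_qubits (conjby Wout X3).

Definition channel_E n T K (phin phout : 'I_K -> 'cV[C]_n) (i0 : 'I_K)
    (rho : 'M[C]_n) : 'M[C]_n :=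
  (K ^ T)%:R^-1 *: \sum_(ks : {ffun 'I_T -> 'I_K}) procedure_run phin phout i0 ks rho.

Definition Dmap n K (phin : 'I_K -> 'cV[C]_n) (X : 'M[C]_n) : 'M[C]_n :=
  K%:R^-1 *: \sum_(k < K) (refl (phin k) *m X *m refl (phin k)).

(* D regarded as a linear map on operators supported on H_in, identified with
   'M_d through an isometry V whose columns form an orthonormal basis of H_in;
   its matrix (acting on mxvec-encoded operators). *)
Definition Dmatrix n d K (phin : 'I_K -> 'cV[C]_n) (V : 'M[C]_(n, d)) :
  'M[C]_(d * d) :=
  lin_mx (fun Y : 'M[C]_(d, d) => adj V *m Dmap phin (V *m Y *m adj V) *m V).

Definition Hin n K (phin : 'I_K -> 'cV[C]_n) : 'M[C]_n :=
  (\sum_(k < K) <<(phin k)^T>>)%MS.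

Definition supported_on n (S : 'M[C]_n) (X : 'M[C]_n) : bool :=
  ((X^T <= S)%MS && ((adj X)^T <= S)%MS).

End QDefs.

(* Main.v *)
Require Import Defs.
From HB Require Import structures.
From mathcomp Require Import all_boot all_order all_algebra complex.
From mathcomp Require Import reals exp ring lra.
Import Order.TTheory GRing.Theory Num.Theory.
Local Open Scope ring_scope.
Local Open Scope complex_scope.

(** Let P project on the first input vector, Q = 1 - P, and let S_k be the reflection about the k-th
    vector. On an ancilla in the minus state, phase kickback makes [Wgate] act as P tensor |0><-|
    plus S_k Q tensor |1><-| ([Wgate_minus]). A system caught by P therefore stays there under fresh
    ancillas, and the part outside P after all gates is what survived every step: unnormalised, it
    evolves by Y -> Q S_k Y S_k Q ([gates_survive]).

    Averaged over the [ks], the survivor evolves by powers of the channel D compressed to operators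
    Q Y Q. For the Hilbert-Schmidt product D is self-adjoint and fixes the identity, and its
    quadratic form on the complement of the identity is at most s = [second_mag]. An operator Q Y Q
    has at most the fraction (d - 1)/d of its squared norm along the identity, so the compression
    has norm at most mu = 1 - (1 - s)/d ([survive_rayleigh]). The average survival probability q is
    then at most mu^T d/2 ([survive_avg_le]), and the choice of T brings this below eps^2/16
    ([geometric_decay]).

    When qubit [c] reads 0 the system is in the first input vector, and replacing it by its image is
    the same as applying U. The output gates are the input gates conjugated by U, so undoing them
    gives U times [adj W] P W on the initial state. This differs from U by a term of squared norm p,
    the survival probability of the run; the outcome 1 costs another p. Tested against a unitary, a
    run is off by at most dl + p/dl + 2p for any dl > 0 ([run_distance_le]).

    The trace norm of the averaged Hermitian error is attained at one unitary ([trnorm_hermitian]),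
    so these bounds may be averaged; being affine in p, they involve only q. With dl = eps/4 the
    total is at most eps ([average_bound]). *)

Set Implicit Arguments.
Unset Strict Implicit.

(** * Adjoints, weighted AM-GM, Hermitian diagonalisation and the trace norm *)

Section Adjoint.
Variable R : realType.
Local Notation C := R[i].

Lemma adjE m n (A : 'M[C]_(m, n)) i j : adj A i j = (A j i)^*%R.
Proof. by rewrite !mxE. Qed.

Lemma adjK m n (A : 'M[C]_(m, n)) : adj (adj A) = A.
Proof. by apply/matrixP => i j; rewrite !adjE conjCK. Qed.

Lemma adjM m n p (A : 'M[C]_(m, n)) (B : 'M[C]_(n, p)) :
  adj (A *m B) = adj B *m adj A.
Proof. by rewrite /adj map_mxM trmx_mul. Qed.

Lemma adjD m n (A B : 'M[C]_(m, n)) : adj (A + B) = adj A + adj B.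
Proof. by rewrite /adj map_mxD linearD. Qed.

Lemma adjB m n (A B : 'M[C]_(m, n)) : adj (A - B) = adj A - adj B.
Proof. by rewrite /adj map_mxB linearB. Qed.

Lemma adj_scale m n a (A : 'M[C]_(m, n)) : adj (a *: A) = a^*%R *: adj A.
Proof. by rewrite /adj map_mxZ linearZ. Qed.

Lemma adj_mx1 n : adj (1%:M : 'M[C]_n) = 1%:M.
Proof. by rewrite /adj map_mx1 trmx1. Qed.

Lemma adj_mx0 m n : adj (0 : 'M[C]_(m, n)) = 0.
Proof. by rewrite /adj map_mx0 trmx0. Qed.

Lemma adj_sum m n I (r : seq I) (F : I -> 'M[C]_(m, n)) :
  adj (\sum_(i <- r) F i) = \sum_(i <- r) adj (F i).
Proof. exact: (big_morph (@adj R m n) (@adjD m n) (adj_mx0 m n)). Qed.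

Lemma adj_delta_mx m n (i : 'I_m) (j : 'I_n) :
  adj (delta_mx i j) = delta_mx j i :> 'M[C]_(n, m).
Proof.
by apply/matrixP => k l; rewrite adjE !mxE andbC rmorph_nat.
Qed.

Lemma tr_adj n (A : 'M[C]_n) : \tr (adj A) = (\tr A)^*%R.
Proof. by rewrite /adj mxtrace_tr trace_map_mx. Qed.

Lemma adj_spectral m n (A : 'M[C]_(m, n)) : map_mx Num.conj (A^T) = adj A.
Proof. by rewrite /adj map_trmx. Qed.

Lemma tr_mul_adj m n (A B : 'M[C]_(m, n)) :
  \tr (A *m adj B) = \sum_i \sum_j A i j * (B i j)^*%R.
Proof.
by apply: eq_bigr => i _; rewrite mxE; apply: eq_bigr => j _; rewrite adjE.
Qed.

Lemma tr_mul_adj_ge0 m n (A : 'M[C]_(m, n)) : 0 <= \tr (A *m adj A).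
Proof.
by rewrite tr_mul_adj; do 2!apply: sumr_ge0 => ? _; rewrite mul_conjC_ge0.
Qed.

(** Weighted AM-GM, from the square of [|b| - |a| / dl]. The free weight [dl] replaces the square
    root of Cauchy-Schwarz, so that bounds stay affine in squared norms and can be averaged. *)
Lemma norm_mul_conj_le (dl a b : C) : 0 < dl ->
  `|a * b^*%R| <= (dl * (b * b^*%R) + dl^-1 * (a * a^*%R)) / 2.
Proof.
move=> dl0; rewrite ler_pdivlMr ?ltr0n// -!normCK normrM norm_conjC.
rewrite -subr_ge0.
have -> : dl * `|b| ^+ 2 + dl^-1 * `|a| ^+ 2 - `|a| * `|b| * 2 =
          dl * (`|b| - dl^-1 * `|a|) ^+ 2.
  by field; rewrite gt_eqF.
apply: mulr_ge0; first exact: ltW.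
rewrite real_exprn_even_ge0// rpredB ?normr_real// rpredM ?normr_real//.
by rewrite rpredV ger0_real// ltW.
Qed.

Lemma norm_tr_mul_adj_le m n (A B : 'M[C]_(m, n)) (dl : C) : 0 < dl ->
  `|\tr (A *m adj B)| <=
    (dl * \tr (B *m adj B) + dl^-1 * \tr (A *m adj A)) / 2.
Proof.
move=> dl0; rewrite !tr_mul_adj.
rewrite !mulr_sumr -big_split mulr_suml /=.
apply: le_trans (ler_norm_sum _ _ _) _; apply: ler_sum => i _.
rewrite !mulr_sumr -big_split mulr_suml /=.
apply: le_trans (ler_norm_sum _ _ _) _; apply: ler_sum => j _.
exact: norm_mul_conj_le.
Qed.

(* Every Hermitian matrix is diagonalized by a unitary one. *)
Lemma hermitian_diag n (A : 'M[C]_n) : adj A = A ->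
  exists (P : 'M[C]_n) (l : 'rV[C]_n),
    [/\ P *m adj P = 1%:M, adj P *m P = 1%:M,
        A = adj P *m diag_mx l *m P & forall i, l 0 i \is Num.real].
Proof.
move=> hA; have nA : A \is hermsymmx.
  by apply/is_hermitianmxP; rewrite expr0 scale1r adj_spectral hA.
have P1 : spectralmx A *m adj (spectralmx A) = 1%:M.
  by rewrite -adj_spectral; apply/unitarymxP/spectral_unitarymx.
exists (spectralmx A), (spectral_diag A); split => //.
- exact: mulmx1C.
- rewrite {1}(orthomx_spectralP (hermitian_normalmx nA)).
  by rewrite invmx_unitary ?spectral_unitarymx// adj_spectral.
- by move=> i; have /mxOverP := hermitian_spectral_diag_real nA; apply.
Qed.

Lemma quad_diag n (P : 'M[C]_n) (l : 'rV[C]_n) (i : 'I_n) : P *m adj P = 1%:M ->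
  let v := adj P *m delta_mx i 0 : 'cV[C]_n in
  (adj v *m (adj P *m diag_mx l *m P) *m v) 0 0 = l 0 i.
Proof.
move=> PP'; rewrite /= adjM adjK -!mulmxA (mulmxA P) PP' mul1mx.
rewrite (mulmxA P) PP' mul1mx -colE.
by rewrite adj_delta_mx -rowE !mxE eqxx mulr1n.
Qed.

(** Unitary similarity preserves the characteristic polynomial. Since [spectrum] is a chosen list of
    its roots, it is determined only up to order. *)
Lemma perm_spectrum n (P : 'M[C]_n) (l : 'rV[C]_n) : adj P *m P = 1%:M ->
  perm_eq (spectrum (adj P *m diag_mx l *m P)) [seq l 0 i | i <- enum 'I_n].
Proof.
move=> PP; have PP' := mulmx1C PP.
apply: prod_XsubC_eq; rewrite -(eqP (xchooseP (spectrum_ex _))).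
rewrite big_map big_enum /=.
have -> : char_poly (adj P *m diag_mx l *m P) = char_poly (diag_mx l).
  rewrite /char_poly /char_poly_mx !map_mxM.
  have e : 'X%:M = map_mx polyC (adj P) *m 'X%:M *m map_mx polyC P.
    by rewrite scalar_mxC -mulmxA -map_mxM PP map_mx1 mulmx1.
  rewrite [in LHS]e -mulmxBl -mulmxBr !det_mulmx mulrAC -det_mulmx -map_mxM PP map_mx1.
  by rewrite det1 mul1r.
rewrite char_poly_trig ?diag_mx_is_trig//.
by apply: eq_bigr => i _; rewrite mxE eqxx mulr1n.
Qed.

(** The unitary is the sign of [A] in an eigenbasis. Having one unitary that attains the norm lets
    the error of an average be bounded run by run. *)
Lemma trnorm_hermitian n (A : 'M[C]_n) : adj A = A ->
  exists2 W : 'M[C]_n, W *m adj W = 1%:M & trnorm A = `|\tr (W *m A)|.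
Proof.
move=> hA; have [P [l [PP' PP eA lR]]] := hermitian_diag hA.
(* Zero eigenvalues get sign 1, which keeps the witness unitary when [A] is singular. *)
pose sg : 'rV[C]_n := \row_i (if 0 <= l 0 i then 1 else -1).
have sgR i : (sg 0 i)^*%R = sg 0 i.
  by apply/CrealP; rewrite mxE; case: ifP => _; [exact: real1 | rewrite realN real1].
have sg2 i : sg 0 i * sg 0 i = 1.
  by rewrite mxE; case: ifP => _; rewrite ?mulrNN mulr1.
exists (adj P *m diag_mx sg *m P).
  rewrite !adjM adjK -!mulmxA (mulmxA P) PP' mul1mx (mulmxA (diag_mx _)).
  have -> : adj (diag_mx sg) = diag_mx sg.
    apply/matrixP => i j; rewrite adjE !mxE eq_sym.
    by have := sgR j; rewrite mxE; case: eqP => [->|_] //=; rewrite ?mulr1n ?mulr0n ?conjC0.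
  rewrite mulmx_diag; have -> : \row_j (sg 0 j * sg 0 j) = const_mx 1.
    by apply/rowP => j; rewrite [LHS]mxE sg2 mxE.
  by rewrite diag_const_mx mul1mx.
pose l2 := \row_j (l 0 j * l 0 j).
have eA2 : adj A *m A = adj P *m diag_mx l2 *m P.
  by rewrite hA {1 2}eA -!mulmxA (mulmxA P) PP' mul1mx (mulmxA (diag_mx _)) mulmx_diag.
have -> : \tr (adj P *m diag_mx sg *m P *m A) = \sum_i `|l 0 i|.
  rewrite {1}eA -!mulmxA (mulmxA P) PP' mul1mx mxtrace_mulC -!mulmxA PP' mulmx1.
  rewrite mulmx_diag mxtrace_diag; apply: eq_bigr => i _; rewrite [LHS]mxE mxE.
  have [_|_] := real_ge0P (lR i); first by rewrite mul1r.
  by rewrite mulN1r.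
rewrite /trnorm eA2 (perm_big _ (perm_spectrum l2 PP)) big_map big_enum /=.
rewrite ger0_norm ?sumr_ge0//; apply: eq_bigr => i _.
by rewrite mxE -expr2 -real_normK ?lR// sqrCK.
Qed.

(* A positive semidefinite rho is a Gram matrix G G^*. *)
Lemma psd_gram n (rho : 'M[C]_n) : psd rho -> exists G : 'M[C]_n, rho = G *m adj G.
Proof.
(* [psd] speaks only of the quadratic form, but a real form forces Hermitian symmetry: [N] has zero
   form, so the Hermitian matrix ['i *: N] has only zero eigenvalues. *)
move=> pr; pose N := rho - adj rho.
have qN (v : 'cV[C]_n) : adj v *m N *m v = 0.
  rewrite /N mulmxBr mulmxBl; apply/matrixP => i j; rewrite !ord1.
  have -> : adj v *m adj rho *m v = adj (adj v *m rho *m v).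
    by rewrite !adjM adjK mulmxA.
  move: (adj v *m rho *m v) (pr v) => c c0.
  have /CrealP cc := ger0_real c0.
  by rewrite [LHS]mxE [X in _ + X]mxE adjE cc subrr mxE.
have skew : adj ('i *: N) = 'i *: N.
  by rewrite adj_scale conjCi /N adjB adjK -opprB scaleNr scalerN opprK.
have [P [l [PP' PP eN _]]] := hermitian_diag skew.
have l0 : l = 0.
  apply/rowP => i; rewrite mxE.
  by rewrite -(quad_diag l i PP') -eN -scalemxAr -scalemxAl qN scaler0 mxE.
have hr : adj rho = rho.
  have : 'i *: N = 0.
    rewrite eN l0; have -> : diag_mx 0 = 0 :> 'M[C]_n by apply/matrixP => i j; rewrite !mxE mul0rn.
    by rewrite mulmx0 mul0mx.
  by move/eqP; rewrite scaler_eq0 (negPf (neq0Ci _)) /= subr_eq0 => /eqP.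
have [P2 [l2 [PP2' PP2 e2 l2R]]] := hermitian_diag hr.
have l2ge i : 0 <= l2 0 i.
  by rewrite -(quad_diag l2 i PP2') -e2; exact: pr.
exists (adj P2 *m diag_mx (\row_i sqrtC (l2 0 i))).
have -> : adj (adj P2 *m diag_mx (\row_i sqrtC (l2 0 i))) =
          diag_mx (\row_i sqrtC (l2 0 i)) *m P2.
  rewrite adjM adjK; congr (_ *m _); apply/matrixP => i j; rewrite adjE !mxE eq_sym.
  case: eqP => [->|_]; rewrite ?mulr0n ?conjC0// !mulr1n; apply/CrealP.
  by rewrite ger0_real// sqrtC_ge0.
rewrite mulmxA -(mulmxA (adj P2)) mulmx_diag {1}e2; congr (_ *m diag_mx _ *m _).
by apply/rowP => i; rewrite !mxE -expr2 sqrtCK.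
Qed.

End Adjoint.

(** * The second largest eigenvalue magnitude as a bound on Rayleigh quotients *)

Section SpectralGap.
Variable R : realType.
Local Notation C := R[i].

(** Identifies the Hilbert-Schmidt product with the product of row vectors, so that superoperators
    become matrices acting on the right of [mxvec]. *)
Lemma mxvec_adj m n (X Y : 'M[C]_(m, n)) :
  mxvec X *m adj (mxvec Y) = (\tr (X *m adj Y))%:M.
Proof.
apply/matrixP => i j; rewrite !ord1 !mxE tr_mul_adj mulr1n.
rewrite (reindex _ (curry_mxvec_bij _ _)) pair_bigA /=.
by apply: eq_bigr => -[k l] _; rewrite adjE !mxvecE.
Qed.

Lemma mulmx_adjE n (x y : 'rV[C]_n) :
  (x *m adj y) 0 0 = \sum_i x 0 i * (y 0 i)^*%R.
Proof. by rewrite mxE; apply: eq_bigr => i _; rewrite adjE. Qed.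

Lemma mulmx_adj_ge0 n (x : 'rV[C]_n) : 0 <= (x *m adj x) 0 0.
Proof. by rewrite mulmx_adjE; apply: sumr_ge0 => i _; rewrite mul_conjC_ge0. Qed.

Lemma adj_mulmx00 n (x y : 'rV[C]_n) :
  (y *m adj x) 0 0 = ((x *m adj y) 0 0)^*%R.
Proof. by rewrite -adjE adjM adjK. Qed.

Lemma cauchy_schwarz n (x y : 'rV[C]_n) :
  `|(x *m adj y) 0 0| ^+ 2 <= (x *m adj x) 0 0 * (y *m adj y) 0 0.
Proof.
rewrite -!adj_spectral -!dotmxE.
by have [] := CauchySchwarz (@dotmx C n) x y.
Qed.

Section SecondLargest.
Variables (N : nat) (M P : 'M[C]_N) (l : 'rV[C]_N).
Hypotheses (PP : adj P *m P = 1%:M) (eM : M = adj P *m diag_mx l *m P).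
Local Notation s := ((second_mag M)%:C).
Let L := sort (fun x y : C => y <= x) [seq `|z| | z <- spectrum M].

Let Lreal : all (fun x : C => 0 <= x) L.
Proof.
by rewrite /L all_sort; apply/allP => _ /mapP [z _ ->]; exact: normr_ge0.
Qed.

Let sE : s = nth 0 L 1.
Proof.
have Lge0 : 0 <= nth 0 L 1.
  have [lt1|ge1] := ltnP 1 (size L); last by rewrite nth_default.
  by rewrite (allP Lreal)// mem_nth.
by rewrite /second_mag -/L; move: (nth 0 L 1) Lge0 => [a b]; rewrite lecE /= => /andP [/eqP -> _].
Qed.

Lemma second_mag_ge0 : 0 <= s.
Proof.
rewrite sE; have [lt1|ge1] := ltnP 1 (size L); last by rewrite nth_default.
by rewrite (allP Lreal)// mem_nth.
Qed.

(** At most one entry of a decreasing list exceeds the entry at position 1, so one eigenvalue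
    strictly above [s] in magnitude leaves room for no other. *)
Lemma second_mag_le (i0 i : 'I_N) : s < `|l 0 i0| -> i != i0 -> `|l 0 i| <= s.
Proof.
move=> gt0 ii0; apply/negPn/negP => ngt.
pose a (x : C) := ~~ (x <= s).
have c1 : (count a L <= 1)%N.
  (* The order on [C] is only partial; it is total on [L] because magnitudes are nonnegative
     reals. *)
  have srt : sorted (fun x y : C => y <= x) L.
    apply: (@sort_sorted_in _ (fun x : C => 0 <= x)).
      by move=> x y x0 y0; rewrite orbC; exact: (real_leVge (ger0_real x0) (ger0_real y0)).
    by have := Lreal; rewrite /L all_sort.
  move: srt; rewrite /a sE; case: L => [|x [|y L']] //=; first by case: (~~ _).
  move=> /andP [_ pL]; rewrite lexx /= add0n.
  have -> : count (fun z : C => ~~ (z <= y)) L' = 0%N.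
    apply/eqP; rewrite -leqn0 leqNgt -has_count; apply/hasPn => z zL.
    rewrite negbK; have tr : transitive (fun x y : C => y <= x).
      by move=> b c e bc ce; exact: le_trans ce bc.
    by have /allP := order_path_min tr pL; apply.
  by case: (~~ _).
have : (1 < count a L)%N.
  have pL : perm_eq L [seq `|l 0 i| | i <- enum 'I_N].
    rewrite /L perm_sort (map_comp Num.norm (fun i => l 0 i)).
    by apply: perm_map; rewrite eM perm_spectrum.
  rewrite (permP pL) count_map -sum1_count big_enum_cond /=.
  rewrite (bigD1 i0) 1?(bigD1 i) ?ii0 ?andbT//=.
    by rewrite /= /a -real_ltNge// ?normr_real ?ger0_real ?second_mag_ge0.
by rewrite ltnNge c1.
Qed.

End SecondLargest.

(** Since [second_mag M < 1], the eigenvalue 1 is simple. In an eigenbasis [u] occupies a single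
    coordinate [i0], a vector orthogonal to [u] vanishes there, and all other eigenvalues are at
    most [second_mag M] in magnitude. *)
Lemma second_mag_rayleigh N (M : 'M[C]_N) (u z : 'rV[C]_N) :
  adj M = M -> u *m M = u -> u != 0 -> second_mag M < 1 -> z *m adj u = 0 ->
  `|(z *m M *m adj z) 0 0| <= (second_mag M)%:C * (z *m adj z) 0 0.
Proof.
move=> hM uM u0 s1 zu.
have [P [l [PP' PP eM lR]]] := hermitian_diag hM.
pose w := u *m adj P; pose y := z *m adj P.
have wl i : w 0 i * l 0 i = w 0 i.
  have : w *m diag_mx l = w.
    by rewrite /w -[in RHS]uM eM -!mulmxA PP' mulmx1.
  by move/rowP/(_ i); rewrite mul_mx_diag mxE.
have [i0 wi0] : exists i0, w 0 i0 != 0.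
  apply/existsP; apply: contraNT u0; rewrite negb_exists => /forallP w0.
  have : w = 0 by apply/rowP => i; rewrite [RHS]mxE; apply/eqP/negPn/w0.
  by move/(congr1 (mulmx^~ P)); rewrite /w -mulmxA PP mulmx1 mul0mx => ->.
have l1 i : w 0 i != 0 -> l 0 i = 1.
  by move=> wi; apply: (mulfI wi); rewrite wl mulr1.
have s1' : (second_mag M)%:C < `|l 0 i0| by rewrite l1// normr1 ltcR.
have ls i : i != i0 -> `|l 0 i| <= (second_mag M)%:C.
  by move=> ii0; exact: (second_mag_le PP eM s1' ii0).
have wi i : i != i0 -> w 0 i = 0.
  move=> ii0; apply/eqP/negPn/negP => wi.
  by have := ls i ii0; rewrite l1// normr1 -[1]/(1%:C) lecR leNgt s1.
have yi0 : y 0 i0 = 0.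
  have : (y *m adj w) 0 0 = 0.
    by rewrite /y /w adjM adjK -mulmxA (mulmxA (adj P)) PP mul1mx zu mxE.
  rewrite mulmx_adjE (bigD1 i0)//= big1 => [|i /wi ->]; last by rewrite conjC0 mulr0.
  by rewrite addr0 => /eqP; rewrite mulf_eq0 conjC_eq0 (negPf wi0) orbF => /eqP.
have -> : z *m M *m adj z = y *m diag_mx l *m adj y.
  by rewrite eM /y adjM adjK !mulmxA.
have -> : z *m adj z = y *m adj y.
  by rewrite /y adjM adjK -mulmxA (mulmxA (adj P)) PP mul1mx.
rewrite !mulmx_adjE mulr_sumr; apply: le_trans (ler_norm_sum _ _ _) _.
apply: ler_sum => i _; rewrite mul_mx_diag mxE.
have [->|ii0] := eqVneq i i0; first by rewrite yi0 !mul0r normr0 mulr0.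
rewrite -mulrA mulrCA normrM [`|_ * _^*%R|]ger0_norm ?mul_conjC_ge0//.
by rewrite ler_wpM2r ?mul_conjC_ge0// ls.
Qed.

End SpectralGap.

(** * Rank-one projectors, their complements and reflections *)

Section Projections.
Variable R : realType.
Local Notation C := R[i].

Lemma adj_ketbra n (v : 'cV[C]_n) : adj (ketbra v) = ketbra v.
Proof. by rewrite /ketbra adjM adjK. Qed.

Lemma adj_refl n (v : 'cV[C]_n) : adj (refl v) = refl v.
Proof. by rewrite /refl adjB adj_mx1 adj_scale conjC_nat adj_ketbra. Qed.

Definition coproj n (v : 'cV[C]_n) : 'M[C]_n := 1%:M - ketbra v.

Lemma adj_coproj n (v : 'cV[C]_n) : adj (coproj v) = coproj v.
Proof. by rewrite /coproj adjB adj_mx1 adj_ketbra. Qed.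

Section Unit.
Variables (n : nat) (v : 'cV[C]_n).
Hypothesis v1 : adj v *m v = 1%:M.

Lemma ketbra_idem : ketbra v *m ketbra v = ketbra v.
Proof. by rewrite /ketbra mulmxA -(mulmxA v) v1 mulmx1. Qed.

Lemma ketbra_coproj : ketbra v *m coproj v = 0.
Proof. by rewrite /coproj mulmxBr mulmx1 ketbra_idem subrr. Qed.

Lemma coproj_ketbra : coproj v *m ketbra v = 0.
Proof. by rewrite /coproj mulmxBl mul1mx ketbra_idem subrr. Qed.

Lemma coproj_idem : coproj v *m coproj v = coproj v.
Proof. by rewrite {1}/coproj mulmxBl mul1mx ketbra_coproj subr0. Qed.

Lemma reflK : refl v *m refl v = 1%:M.
Proof.
rewrite {1}/refl mulmxBl mul1mx -scalemxAl /refl mulmxBr mulmx1 -scalemxAr.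
rewrite ketbra_idem; have -> : ketbra v - 2 *: ketbra v = - ketbra v.
  by rewrite scaler_nat mulr2n opprD addrA subrr sub0r.
by rewrite scalerN opprK subrK.
Qed.

Lemma tr_ketbra : \tr (ketbra v) = 1.
Proof. by rewrite /ketbra mxtrace_mulC v1 mxtrace1. Qed.

Lemma tr_coproj : \tr (coproj v) = n%:R - 1.
Proof. by rewrite /coproj linearB /= mxtrace1 tr_ketbra. Qed.

Lemma unit_dim : (0 < n)%N.
Proof.
case: n v v1 => // w /matrixP/(_ 0 0); rewrite !mxE big_ord0 => /esym/eqP.
by rewrite eqxx oner_eq0.
Qed.

End Unit.

(** Pythagoras: the gap is the squared norm of [A *m (1%:M - Q)]. *)
Lemma tr_mul_proj_le m n (A : 'M[C]_(m, n)) (Q : 'M[C]_n) :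
  adj Q = Q -> Q *m Q = Q -> \tr (A *m Q *m adj (A *m Q)) <= \tr (A *m adj A).
Proof.
move=> hQ QQ; have := tr_mul_adj_ge0 (A *m (1%:M - Q)).
have -> : A *m (1%:M - Q) *m adj (A *m (1%:M - Q)) =
          A *m adj A - A *m Q *m adj (A *m Q).
  have cc : (1%:M - Q) *m (1%:M - Q) = 1%:M - Q.
    by rewrite mulmxBr mulmx1 mulmxBl mul1mx QQ subrr subr0.
  rewrite !adjM adjB adj_mx1 hQ !mulmxA -(mulmxA A) -(mulmxA A Q) cc QQ.
  by rewrite mulmxBr mulmx1 mulmxBl.
by rewrite raddfB /= subr_ge0.
Qed.

End Projections.

(** * Decay of the survival probability, by the compressed channel *)

Section Survival.
Variables (R : realType) (d K : nat) (phi : 'I_K.+1 -> 'cV[R[i]]_d).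
Local Notation C := R[i].
Local Notation Q := (coproj (phi ord0)).
Local Notation S k := (refl (phi k)).

(** One step of the walk conditioned on missing the first vector: reflect, then keep only the part
    orthogonal to that vector. *)
Definition survive_step (k : 'I_K.+1) (Y : 'M[C]_d) : 'M[C]_d :=
  Q *m S k *m Y *m S k *m Q.

Definition survive T (ks : 'I_T -> 'I_K.+1) (r : seq 'I_T) (Y : 'M[C]_d) :=
  foldl (fun Y t => survive_step (ks t) Y) Y r.

Hypothesis phi1 : forall k, adj (phi k) *m phi k = 1%:M.
Variable M : 'M[C]_(d * d).
Hypothesis hM : forall Y, mxvec Y *m M = mxvec (Dmap phi Y).
Hypothesis s1 : second_mag M < 1.
Local Notation s := ((second_mag M)%:C).
Local Notation mu := (1 - (1 - s) / d%:R).
Let u : 'rV[C]_(d * d) := mxvec 1%:M.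
Let compr : 'M[C]_(d * d) := lin_mx (mulmxr Q \o mulmx Q).
Let q : 'rV[C]_(d * d) := mxvec Q.

Let comprE Y : mxvec Y *m compr = mxvec (Q *m Y *m Q).
Proof. by rewrite mul_vec_lin. Qed.

Lemma mxvec_form_inj (A B : 'M[C]_(d * d)) :
  (forall X Y, mxvec X *m A *m adj (mxvec Y) = mxvec X *m B *m adj (mxvec Y)) ->
  A = B.
Proof.
move=> eAB; apply/matrixP => i j.
have := eAB (vec_mx (delta_mx 0 i)) (vec_mx (delta_mx 0 j)).
rewrite !vec_mxK adj_delta_mx.
by rewrite -!rowE -!colE => /matrixP/(_ 0 0); rewrite !mxE.
Qed.

(** Every reflection is Hermitian and can be moved across the trace by cyclicity. *)
Let M_herm : adj M = M.
Proof.
apply: mxvec_form_inj => X Y; rewrite hM mxvec_adj.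
have -> : mxvec X *m adj M *m adj (mxvec Y) = adj (mxvec Y *m M *m adj (mxvec X)).
  by rewrite !adjM adjK mulmxA.
rewrite hM adjM adjK mxvec_adj; congr (_%:M).
rewrite /Dmap adj_scale -scalemxAr -scalemxAl !mxtraceZ; congr (_ * _).
  by rewrite fmorphV rmorph_nat.
rewrite adj_sum mulmx_suml mulmx_sumr !raddf_sum; apply: eq_bigr => k _ /=.
by rewrite !adjM adj_refl !mulmxA [LHS]mxtrace_mulC !mulmxA.
Qed.

(** The identity operator is fixed because reflections square to 1. *)
Let uM : u *m M = u.
Proof.
rewrite hM; congr mxvec; rewrite /Dmap (eq_bigr (fun _ => 1%:M)) => [|k _].
  by rewrite sumr_const card_ord -(scaler_nat _ (1%:M : 'M[C]_d)) scalerA mulVf ?scale1r// pnatr_eq0.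
by rewrite mulmx1 reflK.
Qed.

Let compr_herm : adj compr = compr.
Proof.
apply: mxvec_form_inj => X Y; rewrite comprE mxvec_adj.
have -> : mxvec X *m adj compr *m adj (mxvec Y) = adj (mxvec Y *m compr *m adj (mxvec X)).
  by rewrite !adjM adjK mulmxA.
rewrite comprE adjM adjK mxvec_adj; congr (_%:M).
rewrite !adjM !adj_coproj !mulmxA [LHS]mxtrace_mulC !mulmxA.
by [].
Qed.

Let compr_idem : compr *m compr = compr.
Proof.
apply: mxvec_form_inj => X Y; congr (_ *m _).
by rewrite mulmxA !comprE !mulmxA coproj_idem// -mulmxA coproj_idem.
Qed.

Let q_compr : q *m compr = q.
Proof. by rewrite /q comprE coproj_idem// coproj_idem. Qed.

Let q_norm : (q *m adj q) 0 0 = d%:R - 1.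
Proof. by rewrite mxvec_adj mxE mulr1n adj_coproj coproj_idem// tr_coproj. Qed.

Let s_ge0 : 0 <= s.
Proof.
have [P [l [_ PP eM _]]] := hermitian_diag M_herm.
exact: second_mag_ge0.
Qed.

Let d_gt0 : 0 < d%:R :> C.
Proof. by rewrite ltr0n (unit_dim (phi1 ord0)). Qed.

Lemma survive_rate_ge0 : 0 <= mu.
Proof.
rewrite subr_ge0 ler_pdivrMr// mul1r; apply: (@le_trans _ _ 1).
  by rewrite lerBlDr lerDl.
by rewrite ler1n (unit_dim (phi1 ord0)).
Qed.

(** Split the compressed vector [y] into a multiple of [u], which [M] fixes, and a part [z]
    orthogonal to [u], on which the form of [M] is at most [s]. As [y] lives under [Q], of rank d -
    1, Cauchy-Schwarz with [q] puts at most the fraction (d - 1)/d of its squared norm along [u].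
    The worst split gives (1 - 1/d) + s/d, which is [mu]. *)
Lemma survive_rayleigh (x : 'rV[C]_(d * d)) :
  `|(x *m (compr *m M *m compr) *m adj x) 0 0| <= mu * (x *m adj x) 0 0.
Proof.
have mu0 := survive_rate_ge0; set y := x *m compr.
have -> : x *m (compr *m M *m compr) *m adj x = y *m M *m adj y.
  by rewrite /y adjM compr_herm !mulmxA.
have yx : (y *m adj y) 0 0 <= (x *m adj x) 0 0.
  have := tr_mul_proj_le x compr_herm compr_idem.
  by rewrite /mxtrace !big_ord1.
apply: (@le_trans _ _ (mu * (y *m adj y) 0 0)); last by rewrite ler_wpM2l.
pose t := (y *m adj q) 0 0.
(* In the range of the compression, the overlap with the identity is the overlap with [Q]. *)
have tE : (y *m adj u) 0 0 = t.
  rewrite /t -q_compr /y adjM compr_herm !mulmxA -[X in X *m adj q]mulmxA.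
  rewrite compr_idem -(vec_mxK x) comprE !mxvec_adj !mxE adj_mx1 mulmx1 adj_coproj.
  by rewrite -(mulmxA _ Q Q) coproj_idem.
have t_le : `|t| ^+ 2 / d%:R <= (1 - d%:R^-1) * (y *m adj y) 0 0.
  rewrite ler_pdivrMr//; have := cauchy_schwarz y q; rewrite q_norm -/t.
  move/le_trans; apply; rewrite le_eqVlt; apply/orP; left; apply/eqP.
  by field; rewrite gt_eqF.
have uu : (u *m adj u) 0 0 = d%:R by rewrite mxvec_adj adj_mx1 mulmx1 mxtrace1 mxE mulr1n.
pose a := t / d%:R; pose z := y - a *: u.
have zu : z *m adj u = 0.
  apply/matrixP => i j; rewrite !ord1 /z mulmxBl -scalemxAl.
  by rewrite [LHS]mxE [X in _ + X]mxE [X in - X]mxE uu tE [RHS]mxE /a divfK ?subrr ?gt_eqF.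
have uz : u *m adj z = 0 by rewrite -[LHS]adjK adjM adjK zu adj_mx0.
have yE : y = a *: u + z by rewrite /z addrC subrK.
have anorm : (a *: u *m adj (a *: u)) 0 0 = `|t| ^+ 2 / d%:R.
  rewrite adj_scale -scalemxAl -scalemxAr scalerA mxE uu normCK /a rmorphM /= fmorphV rmorph_nat.
  by field; rewrite gt_eqF.
have az : a *: u *m adj z = 0 by rewrite -scalemxAl uz scaler0.
have za : z *m adj (a *: u) = 0 by rewrite adj_scale -scalemxAr zu scaler0.
have auM : a *: u *m M = a *: u by rewrite -scalemxAl uM.
have Mau : M *m adj (a *: u) = adj (a *: u) by rewrite -{1}M_herm -adjM auM.
have nE : (y *m adj y) 0 0 = `|t| ^+ 2 / d%:R + (z *m adj z) 0 0.
  by rewrite {1 2}yE adjD mulmxDl !mulmxDr az za addr0 add0r mxE anorm.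
have -> : y *m M *m adj y = a *: u *m adj (a *: u) + z *m M *m adj z.
  rewrite {1 2}yE adjD (mulmxDl _ _ M) auM mulmxDl !mulmxDr az addr0.
  by rewrite -(mulmxA z) Mau za add0r.
have u0 : u != 0.
  by apply/eqP => u0; have := uu; rewrite u0 mul0mx mxE => /esym/eqP; rewrite gt_eqF.
have gap := second_mag_rayleigh M_herm uM u0 s1 zu.
rewrite [X in `|X|]mxE anorm; apply: le_trans (ler_normD _ _) _.
rewrite ger0_norm; last by rewrite mulr_ge0 ?exprn_ge0// invr_ge0 ltW.
apply: (@le_trans _ _ (`|t| ^+ 2 / d%:R + s * (z *m adj z) 0 0)).
  by rewrite lerD2l.
have -> : (z *m adj z) 0 0 = (y *m adj y) 0 0 - `|t| ^+ 2 / d%:R by rewrite nE addrC addKr.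
have s1C : 0 <= 1 - s by rewrite subr_ge0 -[1]/(1%:C) lecR ltW.
(* The gap between the two sides is exactly [1 - s] times the slack in [t_le]. *)
move: t_le; rewrite -subr_ge0 => /(mulr_ge0 s1C).
rewrite -[X in _ -> is_true X]subr_ge0; congr (0 <= _).
by field; rewrite gt_eqF.
Qed.

(** The compression of [M] is Hermitian, so its eigenvalues are Rayleigh quotients, bounded by [mu],
    and its powers are diagonal in the same basis. *)
Lemma survive_power_le T (rho : 'M[C]_d) : \tr (rho *m adj rho) <= 1 ->
  `|(mxvec rho *m (compr *m M *m compr) ^+ T *m adj q) 0 0| <= mu ^+ T * (d%:R / 2).
Proof.
have mu0 := survive_rate_ge0; move=> rho1; set B := compr *m M *m compr.
have hB : adj B = B by rewrite /B !adjM M_herm compr_herm mulmxA.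
have [P [l [PP' PP eB lR]]] := hermitian_diag hB.
have lmu i : `|l 0 i| <= mu.
  rewrite -(quad_diag l i PP') -eB.
  set v := adj P *m _; have := survive_rayleigh (adj v); rewrite -/B adjK.
  have -> : (adj v *m v) 0 0 = 1; last by rewrite mulr1.
  by rewrite /v adjM adjK -mulmxA (mulmxA P) PP' mul1mx -colE mxE adjE mxE !eqxx conjC1.
have eBT : B ^+ T = adj P *m diag_mx (\row_i l 0 i ^+ T) *m P.
  elim: T => [|T IH].
    rewrite expr0; have -> : \row_i l 0 i ^+ 0 = const_mx 1 by apply/rowP => i; rewrite !mxE.
    by rewrite diag_const_mx mulmx1 PP.
  rewrite exprS IH {1}eB -[_ * _]/(_ *m _) -!mulmxA (mulmxA P) PP' mul1mx.
  rewrite (mulmxA (diag_mx l)) mulmx_diag !mulmxA; congr (_ *m diag_mx _ *m _).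
  by apply/rowP => i; rewrite !mxE exprS.
pose y := mxvec rho *m adj P; pose w := q *m adj P.
have -> : mxvec rho *m B ^+ T *m adj q = y *m diag_mx (\row_i l 0 i ^+ T) *m adj w.
  by rewrite eBT /y /w adjM adjK !mulmxA.
have ny : (y *m adj y) 0 0 <= 1.
  by rewrite /y adjM adjK -mulmxA (mulmxA (adj P)) PP mul1mx mxvec_adj mxE mulr1n.
have nw : (w *m adj w) 0 0 = d%:R - 1.
  by rewrite /w adjM adjK -mulmxA (mulmxA (adj P)) PP mul1mx q_norm.
clearbody y w; rewrite mulmx_adjE; apply: le_trans (ler_norm_sum _ _ _) _.
(* AM-GM in the eigenbasis: the squared norms are at most 1 for the state and equal to [d - 1] for
   [Q], hence the factor [d / 2]. *)
apply: (@le_trans _ _ (\sum_i mu ^+ T * ((w 0 i * (w 0 i)^*%R + y 0 i * (y 0 i)^*%R) / 2))).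
  apply: ler_sum => i _; rewrite mul_mx_diag !mxE mulrAC mulrC normrM normrX.
  apply: ler_pM; rewrite ?exprn_ge0//; first by rewrite lerXn2r ?nnegrE.
  by have := norm_mul_conj_le (y 0 i) (w 0 i) (@ltr01 C); rewrite invr1 !mul1r.
rewrite -mulr_sumr ler_wpM2l ?exprn_ge0// -mulr_suml ler_wpM2r ?invr_ge0//.
by rewrite big_split /= -!mulmx_adjE nw -lerBrDl subKr.
Qed.

(** Vectorised, a run is an ordered product of the matrices [B (ks t)]. Distributivity turns the sum
    over all [ks] into a power of one sum, which is the compressed average channel. *)
Lemma survive_avg_le T (rho : 'M[C]_d) : \tr (rho *m adj rho) <= 1 ->
  `|(K.+1 ^ T)%:R^-1 * \sum_(ks : {ffun 'I_T -> 'I_K.+1})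
     \tr (survive ks (index_enum 'I_T) (Q *m rho *m Q))| <= mu ^+ T * (d%:R / 2).
Proof.
move=> /survive_power_le; move/(_ T); congr (`|_| <= _).
pose B k : 'M[C]_(d * d) := lin_mx (mulmxr (S k *m Q) \o mulmx (Q *m S k)).
have BE k Y : mxvec Y *m B k = mxvec (survive_step k Y).
  by rewrite mul_vec_lin /= /survive_step !mulmxA.
have Bsum : K.+1%:R^-1 *: (\sum_k B k) = M *m compr.
  apply: mxvec_form_inj => X Y; congr (_ *m _).
  rewrite -scalemxAr mulmx_sumr mulmxA hM comprE /Dmap -scalemxAr -scalemxAl linearZ /=; congr (_ *: _).
  rewrite mulmx_sumr mulmx_suml linear_sum; apply: eq_bigr => k _.
  by rewrite BE /survive_step !mulmxA.
have survB ks Y : \tr (survive ks (index_enum 'I_T) (Q *m Y *m Q)) =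
    (mxvec Y *m compr *m \prod_t B (ks t) *m adj q) 0 0.
  have surv r : forall Y, mxvec (survive ks r Y) = mxvec Y *m \prod_(t <- r) B (ks t).
    elim: r => [|t r IH] Z /=; first by rewrite big_nil mulmx1.
    by rewrite big_cons -[_ * _]/(_ *m _) mulmxA BE -IH.
  rewrite comprE -surv mxvec_adj mxE mulr1n adj_coproj.
  (* A survivor is already supported under [Q], so its trace is its inner product with [q]. *)
  have survQ r : forall Y, Q *m Y *m Q = Y -> survive ks r Y *m Q = survive ks r Y.
    elim: r => [|t r IH] Z /= ZQ; first by rewrite -ZQ -mulmxA coproj_idem.
    apply: IH; rewrite /survive_step !mulmxA coproj_idem// -!mulmxA coproj_idem//.
  by rewrite survQ// !mulmxA coproj_idem// -mulmxA coproj_idem.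
under eq_bigr do rewrite survB.
have -> : \sum_(ks : {ffun 'I_T -> 'I_K.+1})
     (mxvec rho *m compr *m \prod_t B (ks t) *m adj q) 0 0 =
   (mxvec rho *m compr *m (\sum_k B k) ^+ T *m adj q) 0 0.
  rewrite -summxE -mulmx_suml -mulmx_sumr; congr ((_ *m _ *m _) 0 0).
  by rewrite -(bigA_distr_bigA (fun _ k => B k)) prodr_const card_ord.
have -> : \sum_k B k = K.+1%:R *: (M *m compr).
  by rewrite -Bsum scalerA mulfV ?scale1r ?pnatr_eq0.
have -> : (K.+1%:R *: (M *m compr)) ^+ T = (K.+1 ^ T)%:R *: (M *m compr) ^+ T.
  elim: (T) => [|T' IH]; first by rewrite !expr0 expn0 scale1r.
  by rewrite !exprS IH expnS natrM -[_ * _ in LHS]/(_ *m _) -scalemxAl -scalemxAr scalerA.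
(* Idempotence spreads [compr] to both sides of each [M], which restores a Hermitian matrix. *)
have comT : compr *m (M *m compr) ^+ T = (compr *m M *m compr) ^+ T *m compr.
  elim: (T) => [|T' IH]; first by rewrite !expr0 mulmx1 mul1mx.
  by rewrite !exprSr -![_ * _]/(_ *m _) mulmxA IH !mulmxA -!mulmxA compr_idem.
have scal (a b : 'rV[C]_(d * d)) (c : C) (X : 'M[C]_(d * d)) :
    (a *m (c *: X) *m adj b) 0 0 = c * (a *m X *m adj b) 0 0.
  by rewrite -scalemxAr -scalemxAl mxE.
rewrite scal mulrA mulVf ?pnatr_eq0 ?expn_eq0// mul1r.
have -> : adj q = compr *m adj q by rewrite -{1}q_compr adjM compr_herm.
rewrite !mulmxA -(mulmxA (mxvec rho) compr) comT !mulmxA.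
by rewrite -(mulmxA _ compr compr) compr_idem.
Qed.

End Survival.

(** * Operators on the system and the qubits, and the partial trace *)

Section JointAlgebra.
Variables (R : realType) (n T : nat).
Local Notation C := R[i].
Local Notation JI := (JI n T).
Local Notation JOp := (JOp R n T).
Local Notation qubit := (option 'I_T).
Local Notation bits := {ffun option 'I_T -> bool}.

Lemma atJ_mkJ (f : JI -> JI -> C) x y : atJ (mkJ f) x y = f x y.
Proof. by rewrite /atJ /mkJ mxE !enum_rankK. Qed.

Lemma atJ_inj (X Y : JOp) : (forall x y, atJ X x y = atJ Y x y) -> X = Y.
Proof.
move=> XY; apply/matrixP => i j.
by have := XY (enum_val i) (enum_val j); rewrite /atJ !enum_valK.
Qed.

Lemma atJ_mul (X Y : JOp) x y :
  atJ (X *m Y) x y = \sum_i \sum_b atJ X x (i, b) * atJ Y (i, b) y.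
Proof.
rewrite /atJ mxE (reindex (fun z : JI => enum_rank z)) /=; last first.
  by apply: onW_bij; exact: enum_rank_bij.
by rewrite [RHS]pair_bigA /=; apply: eq_bigr => -[].
Qed.

Lemma atJ_adj (X : JOp) x y : atJ (adj X) x y = (atJ X y x)^*%R.
Proof. by rewrite /atJ adjE. Qed.

Lemma atJ_add (X Y : JOp) x y : atJ (X + Y) x y = atJ X x y + atJ Y x y.
Proof. by rewrite /atJ mxE. Qed.

Lemma atJ_sum I (r : seq I) (F : I -> JOp) x y :
  atJ (\sum_(i <- r) F i) x y = \sum_(i <- r) atJ (F i) x y.
Proof. by rewrite /atJ summxE. Qed.

Lemma atJ1 x y : atJ (1%:M : JOp) x y = (x == y)%:R.
Proof. by rewrite /atJ mxE (inj_eq enum_rank_inj). Qed.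

Definition upd (b : bits) (q : qubit) (c : bool) : bits :=
  [ffun s => if s == q then c else b s].

Lemma upd_same b q c : upd b q c q = c.
Proof. by rewrite ffunE eqxx. Qed.

Lemma upd_other b q c s : s != q -> upd b q c s = b s.
Proof. by move=> /negPf sq; rewrite ffunE sq. Qed.

Lemma agree_upd (b z : bits) q :
  [forall s, (s != q) ==> (b s == z s)] = (z == upd b q (z q)).
Proof.
apply/forallP/eqP => [h|-> s].
  apply/ffunP => s; rewrite ffunE; case: eqP => [-> //|/eqP sq].
  by have /implyP/(_ sq)/eqP := h s.
by rewrite ffunE; case: eqP => //= _; rewrite eqxx.
Qed.

(** Only the bit at [q] is free, so the sum over all bit strings in a product with a one-qubit gate
    collapses to two terms. *)
Lemma sum_agree (b : bits) q (F : bits -> C) :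
  \sum_(z : bits) ([forall s, (s != q) ==> (b s == z s)])%:R * F z =
  \sum_c F (upd b q c).
Proof.
under eq_bigr do rewrite agree_upd.
rewrite (partition_big (fun z : bits => z q) predT)//=; apply: eq_bigr => c _.
rewrite (bigD1 (upd b q c)) ?upd_same//= eqxx mul1r big1 ?addr0// => z /andP [/eqP zq].
by rewrite zq => /negPf ->; rewrite mul0r.
Qed.

Lemma sum_eq_bits (b : bits) (F : bits -> C) : \sum_(z : bits) (b == z)%:R * F z = F b.
Proof.
rewrite (bigD1 b)//= eqxx mul1r big1 ?addr0// => z zb.
by rewrite eq_sym (negPf zb) mul0r.
Qed.

Definition sysJ (A : 'M[C]_n) : JOp :=
  mkJ (fun x y => (x.2 == y.2)%:R * A x.1 y.1).

Definition qubJ (q : qubit) (B : bool -> bool -> C) : JOp :=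
  liftq q (fun b b' => (B b b')%:M).

Lemma atJ_liftq_mul q A (X : JOp) x y :
  atJ (liftq q A *m X) x y =
  \sum_c \sum_i A (x.2 q) c x.1 i * atJ X (i, upd x.2 q c) y.
Proof.
rewrite atJ_mul [RHS]exchange_big; apply: eq_bigr => i _ /=.
pose F (z : bits) := A (x.2 q) (z q) x.1 i * atJ X (i, z) y.
rewrite [RHS](eq_bigr (fun c => F (upd x.2 q c))) => [|c _]; last first.
  by rewrite /F upd_same.
by rewrite -sum_agree; apply: eq_bigr => b _; rewrite atJ_mkJ /= mulrA.
Qed.

Lemma atJ_sysJ_mul A (X : JOp) x y :
  atJ (sysJ A *m X) x y = \sum_i A x.1 i * atJ X (i, x.2) y.
Proof.
rewrite atJ_mul; apply: eq_bigr => i _.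
rewrite -[RHS](sum_eq_bits x.2 (fun b => A x.1 i * atJ X (i, b) y)).
by apply: eq_bigr => b _; rewrite atJ_mkJ /= mulrA.
Qed.

Lemma atJ_qubJ_mul q B (X : JOp) x y :
  atJ (qubJ q B *m X) x y =
  \sum_c B (x.2 q) c * atJ X (x.1, upd x.2 q c) y.
Proof.
rewrite atJ_liftq_mul; apply: eq_bigr => c _.
rewrite (bigD1 x.1)//= mxE eqxx mulr1n big1 ?addr0// => i ix.
by rewrite mxE eq_sym (negPf ix) mulr0n mul0r.
Qed.

Lemma adj_liftq q A : adj (liftq q A : JOp) = liftq q (fun b b' => adj (A b' b)).
Proof.
apply: atJ_inj => x y; rewrite atJ_adj !atJ_mkJ adjE rmorphM rmorph_nat /=.
by congr ((nat_of_bool _)%:R * _); apply: eq_forallb => s; rewrite [y.2 s == _]eq_sym.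
Qed.

Lemma adj_qubJ q B : adj (qubJ q B) = qubJ q (fun b b' => (B b' b)^*%R).
Proof.
rewrite /qubJ adj_liftq; apply: atJ_inj => x y; rewrite !atJ_mkJ adjE !mxE.
by rewrite rmorphMn /= [y.1 == _]eq_sym.
Qed.

Lemma adj_sysJ A : adj (sysJ A) = sysJ (adj A).
Proof.
apply: atJ_inj => x y; rewrite atJ_adj !atJ_mkJ adjE rmorphM rmorph_nat.
by rewrite eq_sym.
Qed.

Lemma eq_liftq q A B : (forall b b', A b b' = B b b') ->
  liftq q A = liftq q B :> JOp.
Proof. by move=> AB; apply: atJ_inj => x y; rewrite !atJ_mkJ AB. Qed.

Lemma liftq_mul q A B : liftq q A *m liftq q B =
  liftq q (fun b b' => \sum_c A b c *m B c b') :> JOp.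
Proof.
apply: atJ_inj => x y; rewrite atJ_liftq_mul atJ_mkJ summxE mulr_sumr.
apply: eq_bigr => c _; rewrite mxE mulr_sumr; apply: eq_bigr => i _.
rewrite atJ_mkJ /= upd_same mulrCA; congr ((nat_of_bool _)%:R * _).
by apply: eq_forallb => s; rewrite ffunE; case: eqP.
Qed.

Lemma qubJ_mul q A B :
  qubJ q A *m qubJ q B = qubJ q (fun b b' => \sum_c A b c * B c b').
Proof.
rewrite liftq_mul; apply: eq_liftq => b b'; rewrite raddf_sum /=.
by apply: eq_bigr => c _; rewrite -scalar_mxM.
Qed.

Lemma sysJ_mul A B : sysJ A *m sysJ B = sysJ (A *m B).
Proof.
apply: atJ_inj => x y; rewrite atJ_sysJ_mul atJ_mkJ mxE mulr_sumr.
by apply: eq_bigr => i _; rewrite atJ_mkJ mulrCA.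
Qed.

Lemma sysJ1 : sysJ 1%:M = 1%:M.
Proof.
apply: atJ_inj => -[i b] [j c]; rewrite atJ_mkJ atJ1 mxE -natrM mulnb.
by rewrite xpair_eqE andbC.
Qed.

Lemma sysJB A B : sysJ (A - B) = sysJ A - sysJ B.
Proof.
by apply: atJ_inj => x y; rewrite /atJ !mxE !enum_rankK mulrBr.
Qed.

Lemma sysJ_scale a A : sysJ (a *: A) = a *: sysJ A.
Proof.
by apply: atJ_inj => x y; rewrite /atJ !mxE !enum_rankK mulrCA.
Qed.

Lemma sysJ_sum I (r : seq I) (F : I -> 'M[C]_n) :
  sysJ (\sum_(i <- r) F i) = \sum_(i <- r) sysJ (F i).
Proof.
apply: atJ_inj => x y; rewrite atJ_mkJ atJ_sum summxE mulr_sumr.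
by apply: eq_bigr => i _; rewrite atJ_mkJ.
Qed.

Lemma sysJ_qubJ_comm A q B : sysJ A *m qubJ q B = qubJ q B *m sysJ A.
Proof.
apply: atJ_inj => x y; rewrite atJ_sysJ_mul atJ_qubJ_mul.
under eq_bigr do rewrite atJ_mkJ mxE /=.
rewrite (bigD1 y.1)//= eqxx mulr1n big1 ?addr0 => [|i /negPf ->]; last by rewrite mulr0n !mulr0.
rewrite (bigD1 (y.2 q))//= big1 ?addr0 => [|c cy].
  by rewrite atJ_mkJ /= agree_upd [y.2 == _]eq_sym; ring.
rewrite atJ_mkJ /=; case: eqP => [e|_]; last by rewrite mul0r mulr0.
by move: cy; rewrite -e upd_same eqxx.
Qed.

(** Expansion in matrix units at [q] with system coefficients. It reduces commutation with another
    qubit to [qubJ_comm] and [sysJ_qubJ_comm]. *)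
Lemma liftq_decomp q A :
  liftq q A = \sum_b \sum_b' sysJ (A b b') *m
                qubJ q (fun c c' => ((c == b) && (c' == b'))%:R) :> JOp.
Proof.
apply: atJ_inj => x y; rewrite atJ_sum.
under eq_bigr do rewrite atJ_sum.
rewrite (bigD1 (x.2 q))//= [X in _ + X]big1 ?addr0 => [|b bx]; last first.
  rewrite big1 // => b' _; rewrite sysJ_qubJ_comm atJ_qubJ_mul big1// => c _.
  by rewrite eq_sym (negPf bx) mul0r.
rewrite (bigD1 (y.2 q))//= [X in _ + X]big1 ?addr0 => [|b bx]; last first.
  rewrite atJ_sysJ_mul big1// => i _.
  by rewrite atJ_mkJ [y.2 q == b]eq_sym (negPf bx) andbF mxE mul0rn !mulr0.
rewrite atJ_sysJ_mul atJ_mkJ (bigD1 y.1)//= big1 => [|i iy].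
  by rewrite atJ_mkJ /= mxE !eqxx mulr1n mulr1 addr0 mulrC.
by rewrite atJ_mkJ /= mxE (negPf iy) mulr0n !mulr0.
Qed.

Lemma qubJ_comm q q' A B : q != q' -> qubJ q A *m qubJ q' B = qubJ q' B *m qubJ q A.
Proof.
move=> qq'; apply: atJ_inj => x y; rewrite !atJ_qubJ_mul.
under eq_bigr => c _.
  rewrite -[qubJ q' B]mulmx1 atJ_qubJ_mul /= mulr_sumr.
  over.
under [RHS]eq_bigr => c _.
  rewrite -[qubJ q A]mulmx1 atJ_qubJ_mul /= mulr_sumr.
  over.
rewrite exchange_big; apply: eq_bigr => c _; apply: eq_bigr => c' _.
rewrite !upd_other// 1?eq_sym// mulrCA; congr (_ * (_ * atJ _ (_, _) _)).
apply/ffunP => s; rewrite !ffunE; case: eqP => [->|//]; case: eqP => // e.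
by rewrite e eqxx in qq'.
Qed.

Lemma liftq_qubJ_comm q q' A B : q != q' ->
  liftq q A *m qubJ q' B = qubJ q' B *m liftq q A.
Proof.
move=> qq'; rewrite liftq_decomp mulmx_suml mulmx_sumr; apply: eq_bigr => b _.
rewrite mulmx_suml mulmx_sumr; apply: eq_bigr => b' _.
by rewrite -mulmxA qubJ_comm// !mulmxA sysJ_qubJ_comm.
Qed.

Lemma tr_trace_qubits (X : JOp) : \tr (trace_qubits X) = \tr X.
Proof.
rewrite /mxtrace; under eq_bigr do rewrite mxE.
rewrite pair_bigA [RHS](reindex (fun z : JI => enum_rank z)) /=; last first.
  by apply: onW_bij; exact: enum_rank_bij.
by apply: eq_bigr => -[].
Qed.

Lemma trace_qubits_sysJl A (X : JOp) :
  trace_qubits (sysJ A *m X) = A *m trace_qubits X.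
Proof.
apply/matrixP => i j; rewrite !mxE; under eq_bigr do rewrite atJ_sysJ_mul /=.
rewrite exchange_big; apply: eq_bigr => k _; rewrite mxE mulr_sumr.
by [].
Qed.

Lemma adj_trace_qubits (X : JOp) : adj (trace_qubits X) = trace_qubits (adj X).
Proof.
apply/matrixP => i j; rewrite adjE !mxE rmorph_sum.
by apply: eq_bigr => b _; rewrite atJ_adj.
Qed.

Lemma trace_qubits_sysJr A (X : JOp) :
  trace_qubits (X *m sysJ A) = trace_qubits X *m A.
Proof.
rewrite -[LHS]adjK adj_trace_qubits adjM adj_sysJ trace_qubits_sysJl adjM.
by rewrite adj_trace_qubits !adjK.
Qed.

Lemma trace_qubitsD (X Y : JOp) :
  trace_qubits (X + Y) = trace_qubits X + trace_qubits Y.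
Proof.
apply/matrixP => i j; rewrite !mxE -big_split /=.
by apply: eq_bigr => b _; rewrite atJ_add.
Qed.

Lemma trace_qubitsB (X Y : JOp) :
  trace_qubits (X - Y) = trace_qubits X - trace_qubits Y.
Proof.
apply/matrixP => i j; rewrite !mxE -sumrB /=.
by apply: eq_bigr => b _; rewrite /atJ !mxE.
Qed.

Lemma atJ_mul_qubJ q B (X : JOp) x y :
  atJ (X *m qubJ q B) x y =
  \sum_c atJ X x (y.1, upd y.2 q c) * B c (y.2 q).
Proof.
rewrite -[_ *m _]adjK atJ_adj adjM adj_qubJ atJ_qubJ_mul rmorph_sum /=.
by apply: eq_bigr => c _; rewrite atJ_adj rmorphM /= !conjCK mulrC.
Qed.

(** A partial trace is cyclic for operators on the factor that is traced out. *)
Lemma trace_qubits_cyc q B (X : JOp) :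
  trace_qubits (qubJ q B *m X) = trace_qubits (X *m qubJ q B).
Proof.
apply/matrixP => i j; rewrite !mxE.
under eq_bigr do rewrite atJ_qubJ_mul /=.
under [RHS]eq_bigr do rewrite atJ_mul_qubJ /=.
rewrite !pair_big /=.
(* Exchanging bit [q] of the string with the summed bit matches the two double sums term by term. *)
pose h (p : bits * bool) := (upd p.1 q p.2, p.1 q).
have hK : involutive h.
  move=> [b c]; rewrite /h /= upd_same; congr (_, _); apply/ffunP => s.
  by rewrite !ffunE; case: eqP => // ->.
rewrite (reindex_inj (inv_inj hK)) /=; apply: eq_bigr => -[b c] _ /=.
rewrite upd_same mulrC; congr (atJ X (_, _) _ * _); apply/ffunP => s.
by rewrite !ffunE; case: eqP => // ->.
Qed.

End JointAlgebra.

Arguments sysJ {R n T}.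
Arguments qubJ {R n T}.

(** * Phase kickback: the gates on an ancilla in the minus state *)

Section Gates.
Variables (R : realType) (n T : nat).
Local Notation C := R[i].
Local Notation JI := (JI n T).
Local Notation JOp := (JOp R n T).
Local Notation qubit := (option 'I_T).

(** This is [|b><-|], which turns a minus state into a flag [b]. Likewise [minus_proj] is [|-><-|],
    and [minus_proj q *m X = X] is how it is expressed that qubit [q] is still in the minus
    state. *)
Definition prep (q : qubit) (b : bool) : JOp :=
  qubJ q (fun c c' => (c == b)%:R * minus_amp R c').

Definition minus_proj (q : qubit) : JOp :=
  qubJ q (fun c c' => minus_amp R c * minus_amp R c').

Definition bit_proj (q : qubit) (b : bool) : JOp :=
  qubJ q (fun c c' => ((c == b) && (c' == b))%:R).

Lemma inv_sqrt2K : (sqrtC 2 : C)^-1 * (sqrtC 2)^-1 = 2^-1.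
Proof. by rewrite -invfM -expr2 sqrtCK. Qed.

Lemma minus_amp_real b : (minus_amp R b)^*%R = minus_amp R b.
Proof.
apply/CrealP/realM; first by rewrite realV ger0_real// sqrtC_ge0.
by case: b; [rewrite realN real1 | exact: real1].
Qed.

Lemma minus_amp_norm : \sum_b minus_amp R b * minus_amp R b = 1.
Proof.
rewrite big_bool /minus_amp /= !mulr1 !mulrN1 mulrNN inv_sqrt2K.
by field.
Qed.

Lemma eq_qubJ (q : qubit) B B' : (forall b b', B b b' = B' b b') -> qubJ q B = qubJ q B' :> JOp.
Proof. by move=> BB; apply: eq_liftq => b b'; rewrite BB. Qed.

Lemma sysJ_qubJ (q : qubit) (A : 'M[C]_n) B : sysJ A *m qubJ q B = liftq q (fun b b' => B b b' *: A).
Proof.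
rewrite sysJ_qubJ_comm; apply: atJ_inj => x y; rewrite atJ_qubJ_mul atJ_mkJ mxE.
rewrite (bigD1 (y.2 q))//= big1 ?addr0 => [|c cy].
  by rewrite atJ_mkJ /= agree_upd [y.2 == _]eq_sym; ring.
rewrite atJ_mkJ /=; case: eqP => [e|_]; last by rewrite mul0r mulr0.
by move: cy; rewrite -e upd_same eqxx.
Qed.

Lemma liftqD q A B :
  liftq q A + liftq q B = liftq q (fun b b' => A b b' + B b b') :> JOp.
Proof.
by apply: atJ_inj => x y; rewrite atJ_add !atJ_mkJ mxE mulrDr.
Qed.

Lemma liftq_id q : liftq q (fun b b' => ((b == b')%:R)%:M) = 1%:M :> JOp.
Proof.
apply: atJ_inj => -[i b] [j c]; rewrite atJ_mkJ atJ1 agree_upd /= !mxE.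
rewrite -[_ *+ (i == j)]mulr_natr mulrA -!natrM !mulnb xpair_eqE.
congr (nat_of_bool _)%:R; rewrite andbC; congr (_ && _).
apply/andP/eqP => [[/eqP e /eqP bc]|->]; last first.
  by split; [apply/eqP/ffunP => s; rewrite ffunE; case: eqP => [->|] | rewrite eqxx].
by rewrite e -bc; apply/ffunP => s; rewrite ffunE; case: eqP => [->|].
Qed.

Lemma adj_minus_proj q : adj (minus_proj q) = minus_proj q.
Proof.
rewrite adj_qubJ; apply: eq_qubJ => b b'.
by rewrite rmorphM /= !minus_amp_real mulrC.
Qed.

Lemma adj_bit_proj q b : adj (bit_proj q b) = bit_proj q b.
Proof.
by rewrite adj_qubJ; apply: eq_qubJ => c c'; rewrite rmorph_nat andbC.
Qed.

Lemma adj_prep_mul q b b' :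
  adj (prep q b) *m prep q b' = if b == b' then minus_proj q else 0.
Proof.
rewrite adj_qubJ qubJ_mul.
have -> : (if b == b' then minus_proj q else 0) =
          qubJ q (fun c c' => (b == b')%:R * (minus_amp R c * minus_amp R c')).
  case: eqP => _; first by apply: eq_qubJ => c c'; rewrite mul1r.
  by apply: atJ_inj => x y; rewrite atJ_mkJ /atJ !mxE mul0r mul0rn mulr0.
apply: eq_qubJ => c c'.
have e (b0 : bool) : (((b0 == b)%:R : C) * minus_amp R c)^*%R = (b0 == b)%:R * minus_amp R c.
  by rewrite rmorphM /= rmorph_nat minus_amp_real.
rewrite big_bool !e {e}.
by case: b; case: b'; rewrite /= ?mul0r ?mul1r ?addr0 ?add0r ?mulr0.
Qed.

Lemma bit_proj_prep q b b' :
  bit_proj q b *m prep q b' = if b == b' then prep q b else 0.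
Proof.
rewrite qubJ_mul.
have -> : (if b == b' then prep q b else 0) =
          qubJ q (fun c c' => (b == b')%:R * ((c == b)%:R * minus_amp R c')).
  case: eqP => _; first by apply: eq_qubJ => c c'; rewrite mul1r.
  by apply: atJ_inj => x y; rewrite atJ_mkJ /atJ !mxE mul0r mul0rn mulr0.
apply: eq_qubJ => c c'; rewrite big_bool.
by case: b; case: b'; case: c; rewrite /= ?mul0r ?mul1r ?addr0 ?add0r ?mul0r ?mulr0.
Qed.

Lemma prep_minus q b : prep q b *m minus_proj q = prep q b.
Proof.
rewrite qubJ_mul; apply: eq_qubJ => c c'.
under eq_bigr do rewrite -mulrA (mulrA (minus_amp R _)).
by rewrite -mulr_sumr -mulr_suml minus_amp_norm mul1r.
Qed.

(** The eigenvalue -1 of the reflection on [v] turns the minus state into the plus state, the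
    eigenvalue 1 on the complement leaves it alone, and the Hadamard gate converts the two into
    flags 0 and 1. *)
Lemma hadJ_ctrlR_minus q (v : 'cV[C]_n) :
  hadJ R n q *m ctrlR q v *m minus_proj q =
  sysJ (ketbra v) *m prep q false + sysJ (coproj v) *m prep q true.
Proof.
rewrite !sysJ_qubJ liftqD -[hadJ R n q]/(liftq q _) !liftq_mul.
apply: eq_liftq => b b'; rewrite big_bool /= !big_bool /= !mulmx0 !addr0 !add0r.
rewrite !mulmx1 !mul_mx_scalar -!scalemxAl mul1mx.
have -> : refl v = coproj v - ketbra v.
  by rewrite /refl /coproj scaler_nat mulr2n opprD addrA.
have -> : 1%:M = coproj v + ketbra v by rewrite /coproj subrK.
move: (coproj v) (ketbra v) => Q P.
have comb (x y : C) : x *: (Q - P) + y *: (Q + P) = (y - x) *: P + (x + y) *: Q.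
  by rewrite scalerBr scalerDr addrACA -scalerDl addrC scalerBl [- _ + _]addrC.
rewrite !scalerA comb {comb}; move: inv_sqrt2K; rewrite /minus_amp.
move: (sqrtC 2)^-1 (if b' then _ else _) => h a hh.
congr (_ *: _ + _ *: _); case: b => /=; try by ring.
- by transitivity (h * h * 2 * (h * a)); [ring | rewrite hh mulVf ?pnatr_eq0].
- by transitivity (h * h * 2 * (h * a)); [ring | rewrite hh mulVf ?pnatr_eq0].
Qed.

Lemma ctrlR_prep (q : qubit) (v : 'cV[C]_n) b :
  ctrlR q v *m prep q b = sysJ (if b then refl v else 1%:M) *m prep q b.
Proof.
rewrite sysJ_qubJ liftq_mul; apply: eq_liftq => c c'.
rewrite big_bool !mul_mx_scalar.
by case: b; case: c; rewrite /= ?mul1r ?mul0r ?scale0r ?scaler0 ?addr0 ?add0r.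
Qed.

Lemma sysJ_prep (A : 'M[C]_n) q b : sysJ A *m prep q b = prep q b *m sysJ A.
Proof. exact: sysJ_qubJ_comm. Qed.

(** Flag 0 marks a system caught in [v1], which the second controlled reflection does not touch;
    flag 1 marks the rest, which it reflects. *)
Lemma Wgate_minus q (vk v1 : 'cV[C]_n) :
  Wgate q vk v1 *m minus_proj q =
  sysJ (ketbra v1) *m prep q false + sysJ (refl vk *m coproj v1) *m prep q true.
Proof.
rewrite /Wgate -!mulmxA (mulmxA (hadJ _ _ _)) hadJ_ctrlR_minus mulmxDr.
rewrite !sysJ_prep !mulmxA !ctrlR_prep -!mulmxA -!sysJ_prep !mulmxA !sysJ_mul.
by rewrite mul1mx.
Qed.

(** Flags are orthogonal, so the cross terms vanish in the partial trace and [A], [B] act as Kraus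
    operators. *)
Lemma trace_qubits_prep q (A B : 'M[C]_n) (X : JOp) :
  minus_proj q *m X = X ->
  let L := sysJ A *m prep q false + sysJ B *m prep q true in
  trace_qubits (L *m X *m adj L) =
  A *m trace_qubits X *m adj A + B *m trace_qubits X *m adj B.
Proof.
move=> mX; have prep_tr b b' (Y Z : 'M[C]_n) :
    trace_qubits (sysJ Y *m prep q b *m X *m adj (sysJ Z *m prep q b')) =
    if b == b' then Y *m trace_qubits X *m adj Z else 0.
  rewrite adjM adj_sysJ !mulmxA trace_qubits_sysJr -!mulmxA trace_qubits_sysJl.
  have -> : trace_qubits (prep q b *m (X *m adj (prep q b'))) =
            trace_qubits (adj (prep q b') *m prep q b *m X).
    rewrite /prep adj_qubJ -[in RHS]mulmxA [RHS]trace_qubits_cyc -/(prep q b).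
    by rewrite mulmxA.
  rewrite adj_prep_mul eq_sym mulmxA; case: eqP => _; first by rewrite mX.
  rewrite mul0mx; have -> : trace_qubits (0 : JOp) = 0.
    by rewrite -(subrr (0 : JOp)) trace_qubitsB subrr.
  by rewrite mulmx0 mul0mx.
have expand (E F G H : JOp) : (E + F) *m X *m (G + H) =
    E *m X *m G + E *m X *m H + (F *m X *m G + F *m X *m H).
  by rewrite mulmxDl mulmxDr !mulmxDl addrACA.
by rewrite /= adjD expand !trace_qubitsD !prep_tr /= addr0 add0r.
Qed.

Lemma atJ_bit_proj_mul q b (X : JOp) x y :
  atJ (bit_proj q b *m X) x y = (x.2 q == b)%:R * atJ X x y.
Proof.
rewrite atJ_qubJ_mul (bigD1 (x.2 q))//= big1 ?addr0 => [|c cx].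
  rewrite andbb; congr (_ * atJ X _ _); rewrite [RHS]surjective_pairing.
  by congr (_, _); apply/ffunP => s; rewrite ffunE; case: eqP => [->|].
by case: eqP => [<-|_]; rewrite /= ?(negPf cx) mul0r.
Qed.

Lemma measure_qE q (X : JOp) :
  measure_q q X = \sum_b bit_proj q b *m X *m bit_proj q b.
Proof.
apply: atJ_inj => x y; rewrite atJ_mkJ atJ_sum.
under eq_bigr => b _.
  rewrite -mulmxA atJ_bit_proj_mul -[X *m _]adjK atJ_adj adjM adj_bit_proj.
  rewrite atJ_bit_proj_mul rmorphM rmorph_nat /= atJ_adj conjCK mulrA -natrM mulnb.
  over.
by rewrite big_bool /= -mulrDl -natrD; case: (x.2 q); case: (y.2 q).
Qed.

Lemma hadJ_herm (q : qubit) : adj (hadJ R n q) = hadJ R n q.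
Proof.
rewrite adj_liftq; apply: eq_liftq => b b'; rewrite adj_scale adj_mx1 andbC.
by have /(_ (b && b')) := minus_amp_real; rewrite /minus_amp => ->.
Qed.

Lemma hadJK (q : qubit) : hadJ R n q *m hadJ R n q = 1%:M.
Proof.
rewrite liftq_mul -[RHS](liftq_id q); apply: eq_liftq => b b'.
rewrite big_bool /= -!scalemxAl !mul1mx !scalerA -scalerDl scalemx1.
congr (_%:M); move: inv_sqrt2K; set h := (sqrtC 2)^-1 => hh.
transitivity (h * h * 2 * (b == b')%:R); last by rewrite hh mulVf ?mul1r ?pnatr_eq0.
by case: b; case: b' => /=; ring.
Qed.

Lemma ctrlR_herm (q : qubit) (v : 'cV[C]_n) : adj (ctrlR q v) = ctrlR q v.
Proof.
rewrite /ctrlR adj_liftq; apply: eq_liftq => b b'; rewrite eq_sym.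
by case: eqP => [->|_]; rewrite ?adj_mx0//; case: ifP; rewrite ?adj_refl ?adj_mx1.
Qed.

Lemma ctrlRK (q : qubit) (v : 'cV[C]_n) : adj v *m v = 1%:M -> ctrlR q v *m ctrlR q v = 1%:M.
Proof.
move=> v1; rewrite liftq_mul -[RHS](liftq_id q); apply: eq_liftq => b b'.
have z : (0%:R : C)%:M = 0 :> 'M[C]_n by rewrite -scalemx1 scale0r.
rewrite big_bool; case: b; case: b' => /=.
- by rewrite reflK// mulmx0 addr0.
- by rewrite mulmx0 mul0mx addr0 z.
- by rewrite mulmx0 mul0mx addr0 z.
- by rewrite mulmx0 mulmx1 add0r.
Qed.

End Gates.

Arguments prep {R n T}.
Arguments minus_proj {R n T}.
Arguments bit_proj {R n T}.

(** * Unitarity and covariance of the gates, replacement, and the initial state *)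

Section Circuit.
Variables (R : realType) (n T : nat).
Local Notation C := R[i].
Local Notation JI := (JI n T).
Local Notation JOp := (JOp R n T).
Local Notation qubit := (option 'I_T).

Lemma Wgate_unitary (q : qubit) (vk v1 : 'cV[C]_n) :
  adj vk *m vk = 1%:M -> adj v1 *m v1 = 1%:M ->
  adj (Wgate q vk v1) *m Wgate q vk v1 = 1%:M.
Proof.
move=> k1 v11; rewrite /Wgate.
move: (hadJ_herm R n q) (hadJK R n q) (ctrlR_herm q vk) (ctrlRK q k1)
  (ctrlR_herm q v1) (ctrlRK q v11).
move: (ctrlR q vk) (ctrlR q v1) (hadJ R n q) => A B H hH HH hA AA hB BB.
rewrite !adjM hA hB hH -!mulmxA (mulmxA A) AA mul1mx (mulmxA H) HH mul1mx.
exact: BB.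
Qed.

Lemma sysJ_liftq (q : qubit) (A : 'M[C]_n) B :
  sysJ A *m liftq q B = liftq q (fun b b' => A *m B b b').
Proof.
apply: atJ_inj => x y; rewrite atJ_sysJ_mul atJ_mkJ mxE mulr_sumr.
by apply: eq_bigr => i _; rewrite atJ_mkJ /= mulrCA.
Qed.

Lemma liftq_sysJ (q : qubit) (A : 'M[C]_n) B :
  liftq q B *m sysJ A = liftq q (fun b b' => B b b' *m A).
Proof.
rewrite -[LHS]adjK adjM adj_sysJ adj_liftq sysJ_liftq adj_liftq.
by apply: eq_liftq => b b'; rewrite adjM !adjK.
Qed.

Lemma sysJ_hadJ (A : 'M[C]_n) (q : qubit) : sysJ A *m hadJ R n q = hadJ R n q *m sysJ A.
Proof.
rewrite sysJ_liftq liftq_sysJ; apply: eq_liftq => b b'.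
by rewrite -scalemxAr mulmx1 -scalemxAl mul1mx.
Qed.

Section Unitary.
Variable U : 'M[C]_n.
Hypothesis UU : adj U *m U = 1%:M.

Lemma ctrlR_sys (q : qubit) (v : 'cV[C]_n) :
  ctrlR q (U *m v) = sysJ U *m ctrlR q v *m sysJ (adj U).
Proof.
have UU' := mulmx1C UU.
rewrite sysJ_liftq liftq_sysJ; apply: eq_liftq => b b'.
case: eqP => _; last by rewrite mulmx0 mul0mx.
case: ifP => _; last by rewrite mulmx1 UU'.
rewrite /refl mulmxBr mulmxBl mulmx1 UU' -scalemxAr -scalemxAl.
by rewrite /ketbra adjM !mulmxA.
Qed.

Lemma sysJK (X : JOp) : sysJ (adj U) *m (sysJ U *m X) = X.
Proof. by rewrite mulmxA sysJ_mul UU sysJ1 mul1mx. Qed.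

(** [U] acts on the system only, so it passes the Hadamard gate and the inner factors cancel. *)
Lemma Wgate_sys (q : qubit) (vk v1 : 'cV[C]_n) :
  Wgate q (U *m vk) (U *m v1) = sysJ U *m Wgate q vk v1 *m sysJ (adj U).
Proof.
rewrite /Wgate !ctrlR_sys; have := sysJ_hadJ (adj U) q; have := sysJK.
move: (ctrlR q vk) (hadJ R n q) (ctrlR q v1) => A H B UK UH.
by rewrite -!mulmxA (mulmxA (sysJ (adj U)) H) UH -mulmxA UK.
Qed.

End Unitary.

(** Kraus form of discarding the system and preparing [v], with operators [|v><j|]. *)
Lemma replace_sysE (v : 'cV[C]_n) (X : JOp) :
  replace_sys v X =
  \sum_j sysJ (v *m delta_mx 0 j) *m X *m adj (sysJ (v *m delta_mx 0 j)).
Proof.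
have Kl j (Y : JOp) x y : atJ (sysJ (v *m delta_mx 0 j) *m Y) x y =
    v x.1 0 * atJ Y (j, x.2) y.
  rewrite atJ_sysJ_mul (bigD1 j)//= big1 ?addr0 => [|i ij].
    by rewrite mxE big_ord1 mxE !eqxx mulr1.
  by rewrite mxE big_ord1 mxE (negPf ij) andbF mulr0 mul0r.
apply: atJ_inj => x y; rewrite atJ_mkJ atJ_sum mulr_sumr; apply: eq_bigr => j _.
rewrite -mulmxA Kl -[X *m _]adjK atJ_adj adjM adjK Kl rmorphM /= atJ_adj conjCK.
by rewrite mulrA.
Qed.

Lemma atJ_init rho (x y : JI) : atJ (init_state T rho) x y =
  rho x.1 y.1 * (\prod_q minus_amp R (x.2 q)) * \prod_q minus_amp R (y.2 q).
Proof. exact: atJ_mkJ. Qed.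

Lemma minus_proj_init (q : qubit) (rho : 'M[C]_n) : minus_proj q *m init_state T rho = init_state T rho.
Proof.
apply: atJ_inj => x y; rewrite atJ_qubJ_mul atJ_init.
have prod_upd c : \prod_q' minus_amp R (upd x.2 q c q') =
    minus_amp R c * \prod_(q' | q' != q) minus_amp R (x.2 q').
  rewrite (bigD1 q)//= upd_same; congr (_ * _); apply: eq_bigr => q' qq'.
  by rewrite upd_other.
under [LHS]eq_bigr do rewrite atJ_init /= prod_upd.
have -> : \prod_q' minus_amp R (x.2 q') =
    minus_amp R (x.2 q) * \prod_(q' | q' != q) minus_amp R (x.2 q').
  by rewrite (bigD1 q).
rewrite -[RHS]mul1r -(minus_amp_norm R) mulr_suml.
by apply: eq_bigr => c _; ring.
Qed.

Lemma trace_qubits_init (rho : 'M[C]_n) : trace_qubits (init_state T rho) = rho.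
Proof.
apply/matrixP => i j; rewrite mxE; under eq_bigr do rewrite atJ_init /= -mulrA -big_split /=.
rewrite -mulr_sumr -(bigA_distr_bigA (fun _ b => minus_amp R b * minus_amp R b)).
by rewrite big1 ?mulr1// => q _; exact: minus_amp_norm.
Qed.

(** [G] tensored with the product of minus states, as a rectangular factor of the initial state. It
    lets a mixed input be handled like a vector, with [\tr (A *m adj A)] as squared norm. *)
Definition init_gram (G : 'M[C]_n) : 'M[C]_(#|{: JI}|, n) :=
  \matrix_(k, j) (G (enum_val k : JI).1 j * \prod_q minus_amp R ((enum_val k : JI).2 q)).

Lemma init_gramE G : init_state T (G *m adj G) = init_gram G *m adj (init_gram G).
Proof.
apply/matrixP => k l; rewrite !mxE mulr_suml mulr_suml; apply: eq_bigr => j _.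
rewrite !adjE !mxE rmorphM rmorph_prod /=.
have -> : \prod_q (minus_amp R ((enum_val l : JI).2 q))^*%R = \prod_q minus_amp R ((enum_val l : JI).2 q).
  by apply: eq_bigr => q _; rewrite minus_amp_real.
by ring.
Qed.

(** Testing the reduced operator with [W] is testing the joint one with [sysJ W], which is unitary
    and leaves the norm of [A] unchanged. *)
Lemma tr_sys_mul_adj_le (W : 'M[C]_n) k (A B : 'M[C]_(#|{: JI}|, k)) (dl : C) :
  W *m adj W = 1%:M -> 0 < dl ->
  `|\tr (W *m trace_qubits (A *m adj B))| <=
     (dl * \tr (B *m adj B) + dl^-1 * \tr (A *m adj A)) / 2.
Proof.
move=> WW dl0; rewrite -trace_qubits_sysJl tr_trace_qubits mulmxA.
apply: le_trans (norm_tr_mul_adj_le _ _ dl0) _.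
suff -> : \tr (sysJ W *m A *m adj (sysJ W *m A)) = \tr (A *m adj A) by [].
rewrite adjM adj_sysJ mxtrace_mulC -mulmxA (mulmxA (sysJ (adj W))).
by rewrite sysJ_mul (mulmx1C WW) sysJ1 mul1mx mxtrace_mulC.
Qed.

End Circuit.

(** * The sequence of gates and the survival walk *)

Section Emulation.
Variables (R : realType) (n T K : nat).
Local Notation C := R[i].
Local Notation JI := (JI n T).
Local Notation JOp := (JOp R n T).
Local Notation qubit := (option 'I_T).

Variables (phi : 'I_K.+1 -> 'cV[C]_n) (ks : 'I_T -> 'I_K.+1).
Hypothesis phi1 : forall k, adj (phi k) *m phi k = 1%:M.
Local Notation P := (ketbra (phi ord0)).
Local Notation Q := (coproj (phi ord0)).

(** The reversed product makes the head of [r] act first, in agreement with the left fold in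
    [survive]. *)
Definition gates (psi : 'I_K.+1 -> 'cV[C]_n) (r : seq 'I_T) : JOp :=
  \big[(fun A B => B *m A)/1%:M]_(t <- r)
    Wgate (Some t) (psi (ks t)) (psi ord0).

Lemma gates_nil psi : gates psi [::] = 1%:M.
Proof. by rewrite /gates big_nil. Qed.

Lemma gates_cons psi t r :
  gates psi (t :: r) = gates psi r *m Wgate (Some t) (psi (ks t)) (psi ord0).
Proof. by rewrite /gates big_cons. Qed.

Lemma gates_unitary r : adj (gates phi r) *m gates phi r = 1%:M.
Proof.
elim: r => [|t r IH]; first by rewrite gates_nil adj_mx1 mul1mx.
rewrite gates_cons; have := Wgate_unitary (Some t) (phi1 (ks t)) (phi1 ord0).
move: (Wgate _ _ _) => W WW.
by rewrite adjM -mulmxA (mulmxA (adj (gates phi r))) IH mul1mx.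
Qed.

Lemma Wgate_comm (q q' : qubit) B (vk v1 : 'cV[C]_n) : q != q' ->
  Wgate q vk v1 *m qubJ q' B = qubJ q' B *m Wgate q vk v1.
Proof.
move=> qq'; rewrite /Wgate.
have ctrl_comm (v : 'cV[C]_n) :
    ctrlR q v *m qubJ q' B = qubJ q' B *m ctrlR q v by exact: liftq_qubJ_comm.
have had_comm : hadJ R n q *m qubJ q' B = qubJ q' B *m hadJ R n q.
  exact: liftq_qubJ_comm.
move: (ctrl_comm vk) (ctrl_comm v1) had_comm.
move: (ctrlR q vk) (ctrlR q v1) (hadJ R n q) (qubJ _ _) => A D H E AE DE HE.
by rewrite -mulmxA DE mulmxA -(mulmxA A) HE mulmxA AE !mulmxA.
Qed.

Lemma gates_comm r B : gates phi r *m qubJ None B = qubJ None B *m gates phi r.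
Proof.
elim: r => [|t r IH]; first by rewrite gates_nil mul1mx mulmx1.
rewrite gates_cons; have := @Wgate_comm (Some t) None B (phi (ks t)) (phi ord0) isT.
move: (Wgate _ _ _) => W WB.
by rewrite -mulmxA WB !mulmxA IH.
Qed.

Lemma gates_sys (U : 'M[C]_n) r : adj U *m U = 1%:M ->
  gates (fun k => U *m phi k) r = sysJ U *m gates phi r *m sysJ (adj U).
Proof.
move=> UU; elim: r => [|t r IH].
  rewrite !gates_nil; have : sysJ U *m sysJ (adj U) = 1%:M :> JOp.
    by rewrite sysJ_mul (mulmx1C UU) sysJ1.
  by move: (sysJ U) (sysJ (adj U)) => A B e; rewrite mulmx1 e.
rewrite !gates_cons IH (Wgate_sys UU); have := @sysJK R n T U UU.
move: (Wgate _ _ _) (sysJ U) (sysJ (adj U)) => W S S' SK.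
by rewrite -!mulmxA SK !mulmxA.
Qed.

Lemma adj_gates psi r :
  \big[(fun A B => A *m B)/1%:M]_(t <- r)
    adj (Wgate (Some t) (psi (ks t)) (psi ord0)) = adj (gates psi r).
Proof.
elim: r => [|t r IH]; first by rewrite big_nil gates_nil adj_mx1.
by rewrite big_cons IH gates_cons adjM.
Qed.

(** Induction on the gates. The first gate splits the reduced state into a caught part, killed by
    the sandwich with [Q], and a reflected remainder, which is one [survive_step]. *)
Lemma gates_survive r (X : JOp) : uniq r -> adj X = X ->
  (forall t, t \in r -> minus_proj (Some t) *m X = X) ->
  \tr (sysJ Q *m (gates phi r *m X *m adj (gates phi r))) =
  \tr (survive phi ks r (Q *m trace_qubits X *m Q)).
Proof.
elim: r X => [|t r IH] X /=.
  move=> _ _ _; rewrite gates_nil mul1mx adj_mx1 mulmx1.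
  rewrite -tr_trace_qubits trace_qubits_sysJl [RHS]mxtrace_mulC mulmxA.
  by rewrite coproj_idem.
move=> /andP [tr ur] hX mX; rewrite gates_cons.
have mt : minus_proj (Some t) *m X = X by apply: mX; rewrite mem_head.
have Xm : X *m minus_proj (Some t) = X.
  by have := congr1 (@adj R _ _) mt; rewrite adjM adj_minus_proj hX.
have WE : Wgate (Some t) (phi (ks t)) (phi ord0) *m X *m
    adj (Wgate (Some t) (phi (ks t)) (phi ord0)) =
    let L := sysJ P *m prep (Some t) false +
             sysJ (refl (phi (ks t)) *m Q) *m prep (Some t) true in
    L *m X *m adj L.
  rewrite -(Wgate_minus (Some t)); move: (Wgate _ _ _) => W /=.
  by rewrite adjM adj_minus_proj -!mulmxA (mulmxA X) Xm (mulmxA (minus_proj _) X) mt.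
have trW := trace_qubits_prep P (refl (phi (ks t)) *m Q) mt.
rewrite /= in WE trW; rewrite -WE {WE} in trW.
(* The later ancillas are still in the minus state after the gate on [t], because [r] has no
   repetition. *)
have comW s : s \in r -> minus_proj (Some s) *m Wgate (Some t) (phi (ks t)) (phi ord0) =
    Wgate (Some t) (phi (ks t)) (phi ord0) *m minus_proj (Some s).
  move=> sr; rewrite Wgate_comm//; apply: contraNneq tr => -[->]//.
move: (Wgate _ _ _) trW comW => W trW comW.
have -> : gates phi r *m W *m X *m adj (gates phi r *m W) =
    gates phi r *m (W *m X *m adj W) *m adj (gates phi r) by rewrite adjM !mulmxA.
rewrite (IH (W *m X *m adj W) ur); last 2 first.
- by rewrite !adjM adjK hX mulmxA.
- by move=> s sr; rewrite !mulmxA comW// -(mulmxA W) mX// inE sr orbT.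
rewrite trW mulmxDr mulmxDl /survive_step.
have -> : Q *m (P *m trace_qubits X *m adj P) *m Q = 0.
  by rewrite -(mulmxA P) (mulmxA Q P) coproj_ketbra// !mul0mx.
by rewrite add0r adjM adj_coproj adj_refl !mulmxA.
Qed.

End Emulation.

(** * Measurement of [c] and replacement of the system *)

Section RunError.
Variables (R : realType) (n T : nat).
Local Notation C := R[i].
Local Notation JI := (JI n T).
Local Notation JOp := (JOp R n T).
Local Notation qubit := (option 'I_T).

(** Phase kickback writes into [c] whether the system is in [v], so the outcomes select the two
    terms of [hadJ_ctrlR_minus] without cross terms. *)
Lemma measure_step (v : 'cV[C]_n) (X : JOp) :
  adj X = X -> minus_proj None *m X = X ->
  measure_q None (conjby (hadJ R n None) (conjby (ctrlR None v) X)) =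
  conjby (sysJ (ketbra v) *m prep None false) X +
  conjby (sysJ (coproj v) *m prep None true) X.
Proof.
move=> hX mX; have Xm : X *m minus_proj None = X.
  by have := congr1 (@adj R _ _) mX; rewrite adjM adj_minus_proj hX.
have := @hadJ_ctrlR_minus R n T None v; rewrite /conjby.
set L0 := sysJ (ketbra v) *m _; set L1 := sysJ (coproj v) *m _.
have B0 : bit_proj None false *m (L0 + L1) = L0.
  rewrite mulmxDr /L0 /L1 !sysJ_prep !mulmxA !bit_proj_prep /= mul0mx addr0.
  by [].
have B1 : bit_proj None true *m (L0 + L1) = L1.
  rewrite mulmxDr /L0 /L1 !sysJ_prep !mulmxA !bit_proj_prep /= mul0mx add0r.
  by [].
move: (adj_minus_proj R n (None : qubit)) mX Xm.
rewrite measure_qE big_bool.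
move: (adj_bit_proj R n (None : qubit) false) (adj_bit_proj R n (None : qubit) true) B0 B1.
move: (bit_proj None false) (bit_proj None true) (hadJ R n None) (ctrlR None v)
  (minus_proj None) L0 L1 => E0 E1 H D m L0 L1 hE0 hE1 B0 B1 hm mX Xm HD.
have -> : H *m (D *m X *m adj D) *m adj H = (L0 + L1) *m X *m adj (L0 + L1).
  rewrite -HD !adjM hm -!mulmxA (mulmxA m X) mX (mulmxA X m) Xm.
  by [].
have sandwich (E L S : JOp) : adj E = E -> E *m S = L ->
    E *m (S *m X *m adj S) *m E = L *m X *m adj L.
  by move=> hE <-; rewrite adjM hE !mulmxA.
by rewrite (sandwich _ _ _ hE0 B0) (sandwich _ _ _ hE1 B1) addrC.
Qed.

Lemma replace_sysD (v : 'cV[C]_n) (X Y : JOp) :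
  replace_sys v (X + Y) = replace_sys v X + replace_sys v Y.
Proof.
rewrite !replace_sysE -big_split; apply: eq_bigr => j _ /=.
by move: (sysJ _) => S; rewrite mulmxDr mulmxDl.
Qed.

(** Once projected on [v], the system is in a known state, and preparing [U *m v] afresh amounts to
    applying [U]. The Kraus terms agree up to weights [|v_j|^2], of sum 1. *)
Lemma replace_sys_ketbra (U : 'M[C]_n) (v : 'cV[C]_n) (X : JOp) :
  adj v *m v = 1%:M ->
  replace_sys (U *m v) (conjby (sysJ (ketbra v)) X) = conjby (sysJ (U *m ketbra v)) X.
Proof.
move=> v1; rewrite replace_sysE.
have e j : sysJ (U *m v *m delta_mx 0 j) *m sysJ (ketbra v) =
    v j 0 *: sysJ (U *m ketbra v) :> JOp.
  rewrite sysJ_mul -sysJ_scale; congr sysJ.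
  rewrite /ketbra -!mulmxA (mulmxA (delta_mx 0 j)) -rowE.
  have -> : row j v = (v j 0)%:M by apply/matrixP => k l; rewrite !ord1 !mxE eqxx mulr1n.
  by rewrite mul_scalar_mx -!scalemxAr.
rewrite (eq_bigr (fun j => (v j 0 * (v j 0)^*%R) *: conjby (sysJ (U *m ketbra v)) X)).
  rewrite -scaler_suml.
  have -> : \sum_j v j 0 * (v j 0)^*%R = 1; last by rewrite scale1r.
  have := congr1 (fun M : 'M[C]_1 => M 0 0) v1; rewrite /= mxE [RHS]mxE eqxx mulr1n => <-.
  by apply: eq_bigr => j _; rewrite adjE mulrC.
move=> j _; rewrite /conjby; have := e j.
move: (sysJ (U *m v *m delta_mx 0 j)) (sysJ (ketbra v)) (sysJ (U *m ketbra v)) => A B D AB.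
have -> : A *m (B *m X *m adj B) *m adj A = (A *m B) *m X *m adj (A *m B).
  by rewrite adjM !mulmxA.
by rewrite AB adj_scale -!scalemxAl -scalemxAr scalerA.
Qed.

Lemma tr_replace_sys (v : 'cV[C]_n) (X : JOp) :
  adj v *m v = 1%:M -> \tr (replace_sys v X) = \tr X.
Proof.
move=> v1; rewrite replace_sysE raddf_sum /=.
have e j : \tr (sysJ (v *m delta_mx 0 j) *m X *m adj (sysJ (v *m delta_mx 0 j))) =
    \tr (sysJ (delta_mx j j) *m X).
  rewrite mxtrace_mulC mulmxA adj_sysJ sysJ_mul; congr (\tr (sysJ _ *m _)).
  rewrite adjM -mulmxA (mulmxA (adj v)) v1 mul1mx.
  by rewrite adj_delta_mx mul_delta_mx.
under eq_bigr do rewrite e.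
by rewrite -raddf_sum -mulmx_suml -sysJ_sum -mx1_sum_delta sysJ1 mul1mx.
Qed.

End RunError.

(** * Decomposition of a run by the outcome of [c] *)

Section RunBound.
Variables (R : realType) (n T K : nat).
Local Notation C := R[i].
Local Notation JI := (JI n T).
Local Notation JOp := (JOp R n T).

Lemma conjby_mul (A B X : JOp) : conjby A (conjby B X) = conjby (A *m B) X.
Proof. by rewrite /conjby adjM !mulmxA. Qed.

Lemma conjby_gram (A : JOp) m (Y : 'M[C]_(_, m)) :
  conjby A (Y *m adj Y) = (A *m Y) *m adj (A *m Y).
Proof. by rewrite /conjby adjM !mulmxA. Qed.

Lemma conjbyD (A X Y : JOp) : conjby A (X + Y) = conjby A X + conjby A Y.
Proof. by rewrite /conjby mulmxDr mulmxDl. Qed.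

Lemma trace_qubits_conj_sysJ A (X : JOp) :
  trace_qubits (conjby (sysJ A) X) = A *m trace_qubits X *m adj A.
Proof. by rewrite /conjby adj_sysJ trace_qubits_sysJr trace_qubits_sysJl. Qed.

Lemma trace_qubits_conj_prep q b (X : JOp) : X *m minus_proj q = X ->
  trace_qubits (conjby (prep q b) X) = trace_qubits X.
Proof.
move=> Xm; have pp := @adj_prep_mul R n T q b b; rewrite eqxx in pp.
rewrite /conjby -mulmxA {1}/prep trace_qubits_cyc -/(prep q b).
by rewrite -mulmxA pp Xm.
Qed.

Variables (phi : 'I_K.+1 -> 'cV[C]_n) (ks : {ffun 'I_T -> 'I_K.+1}).
Variables (U G : 'M[C]_n).
Hypothesis phi1 : forall k, adj (phi k) *m phi k = 1%:M.
Hypothesis UU : adj U *m U = 1%:M.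
Local Notation P := (ketbra (phi ord0)).
Local Notation Q := (coproj (phi ord0)).
Let rho := G *m adj G.
Let W : JOp := gates ks phi (index_enum 'I_T).
Let X : 'M[C]_(#|{: JI}|, n) := init_gram T G.
Let X1 : JOp := conjby W (init_state T rho).
Let Wout : JOp := sysJ U *m adj W *m sysJ (adj U).

Let WW : adj W *m W = 1%:M. Proof. exact: gates_unitary. Qed.

Let X1E : X1 = (W *m X) *m adj (W *m X).
Proof. by rewrite /X1 /conjby /rho init_gramE adjM !mulmxA. Qed.

Let X1_herm : adj X1 = X1.
Proof. by rewrite X1E adjM adjK. Qed.

Let X1_minus : minus_proj None *m X1 = X1.
Proof.
rewrite /X1 /conjby !mulmxA /minus_proj -gates_comm -/(minus_proj None).
by rewrite -(mulmxA _ _ (init_state T rho)) minus_proj_init.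
Qed.

(** The summands are the outcomes 0 and 1. In the first the replacement has become an application of
    [U]; in the second it stays a replacement. *)
Lemma procedure_runE :
  procedure_run phi (fun k => U *m phi k) ord0 ks rho =
  trace_qubits (conjby Wout (conjby (sysJ (U *m P) *m prep None false) X1)) +
  trace_qubits (conjby Wout (replace_sys (U *m phi ord0)
    (conjby (sysJ Q *m prep None true) X1))).
Proof.
rewrite /procedure_run.
have -> : \big[(fun A B => B *m A)/1%:M]_(t < T)
    Wgate (Some t) (phi (ks t)) (phi ord0) = W by [].
rewrite (adj_gates ks (fun k => U *m phi k)).
rewrite (gates_sys _ _ _ UU) -/W !adjM !adj_sysJ adjK mulmxA -/Wout -/X1.
rewrite (measure_step _ X1_herm X1_minus) replace_sysD.
rewrite -(conjby_mul (sysJ P)) (replace_sys_ketbra _ _ (phi1 ord0)) conjby_mul.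
by rewrite conjbyD trace_qubitsD.
Qed.

(** The [adj U] inside [Wout] cancels the [U] of the replacement, so the input gates are undone
    around the projection [P]. The gates do not touch [c], whose flag traces out. *)
Lemma success_branchE :
  trace_qubits (conjby Wout (conjby (sysJ (U *m P) *m prep None false) X1)) =
  U *m trace_qubits ((adj W *m sysJ P *m W *m X) *m adj (adj W *m sysJ P *m W *m X))
    *m adj U.
Proof.
have Wqub (B : bool -> bool -> C) : adj W *m qubJ None B = qubJ None B *m adj W.
  have := @gates_comm R n T K phi ks (index_enum 'I_T) B; rewrite -/W.
  move: WW (qubJ None B) => WW' p Wp.
  rewrite -[LHS]mulmx1 -(mulmx1C WW') mulmxA; congr (_ *m _).
  by rewrite -(mulmxA _ p) -Wp mulmxA WW' mul1mx.
pose D0 := adj W *m sysJ P; pose D := sysJ U *m D0.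
have Dqub (B : bool -> bool -> C) : D *m qubJ None B = qubJ None B *m D.
  rewrite /D /D0; have Pp := sysJ_qubJ_comm P (None : option 'I_T) B.
  have Up := sysJ_qubJ_comm U (None : option 'I_T) B.
  move: Pp Up (Wqub B).
  move: (sysJ U) (sysJ P) (qubJ None B) (adj W) => u q p w Pp Up Wp.
  by rewrite -!mulmxA Pp (mulmxA w p) Wp -!mulmxA (mulmxA u p) Up -!mulmxA.
have e : Wout *m (sysJ (U *m P) *m prep None false) = prep None false *m D.
  rewrite -Dqub -/(prep None false) /Wout /D /D0 -sysJ_mul.
  have := @sysJK R n T U UU.
  move: (sysJ U) (sysJ (adj U)) (sysJ P) (prep None false) (adj W) => u u' q p w SK.
  by rewrite -!mulmxA SK.
have m_D : adj D *m minus_proj None = minus_proj None *m adj D.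
  have := congr1 (@adj R _ _) (Dqub (fun c c' => minus_amp R c * minus_amp R c')).
  rewrite -/(minus_proj None) => h.
  by move: h; rewrite !adjM adj_minus_proj => ->.
have X1m : X1 *m minus_proj None = X1.
  by have := congr1 (@adj R _ _) X1_minus; rewrite adjM adj_minus_proj X1_herm.
rewrite conjby_mul e -conjby_mul trace_qubits_conj_prep; last first.
  by rewrite /conjby -mulmxA m_D mulmxA -(mulmxA D) X1m.
by rewrite /D -conjby_mul trace_qubits_conj_sysJ X1E conjby_gram /D0 !mulmxA.
Qed.

End RunBound.

(** * Error of a single run *)

Section RunDistance.
Variables (R : realType) (n T K : nat).
Local Notation C := R[i].
Local Notation JI := (JI n T).
Local Notation JOp := (JOp R n T).

Lemma tr_conjby (A X : JOp) : adj A *m A = 1%:M -> \tr (conjby A X) = \tr X.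
Proof. by move=> AA; rewrite /conjby mxtrace_mulC mulmxA AA mul1mx. Qed.

Lemma trace_qubits_sum I (r : seq I) (F : I -> JOp) :
  trace_qubits (\sum_(i <- r) F i) = \sum_(i <- r) trace_qubits (F i).
Proof.
have t0 : trace_qubits (0 : JOp) = 0.
  by rewrite -(subrr (0 : JOp)) trace_qubitsB subrr.
exact: (big_morph _ (@trace_qubitsD R n T) t0).
Qed.

Lemma conjby_sum I (r : seq I) (A : JOp) (F : I -> JOp) :
  conjby A (\sum_(i <- r) F i) = \sum_(i <- r) conjby A (F i).
Proof. by rewrite /conjby mulmx_sumr mulmx_suml. Qed.

Lemma tr_conj_coproj (Q : 'M[C]_n) (X : JOp) : adj Q = Q -> Q *m Q = Q ->
  \tr (conjby (sysJ Q) X) = \tr (sysJ Q *m X).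
Proof.
move=> hQ QQ; rewrite -tr_trace_qubits trace_qubits_conj_sysJ hQ mxtrace_mulC.
by rewrite mulmxA QQ -tr_trace_qubits trace_qubits_sysJl.
Qed.

Lemma gram_sub m k (x e : 'M[C]_(m, k)) : x *m adj x - (x - e) *m adj (x - e) =
  x *m adj e + e *m adj x - e *m adj e.
Proof.
rewrite adjB mulmxBr !mulmxBl.
move: (x *m adj x) (x *m adj e) (e *m adj x) (e *m adj e) => a b c d.
by rewrite !opprB addrC addrA subrK addrAC.
Qed.

Lemma tr_sys_gram_le (V : 'M[C]_n) k (B : 'M[C]_(#|{: JI}|, k)) :
  V *m adj V = 1%:M -> `|\tr (V *m trace_qubits (B *m adj B))| <= \tr (B *m adj B).
Proof.
move=> VV; have := @tr_sys_mul_adj_le R n T V k B B 1 VV ltr01.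
by move: (\tr (B *m _)) => b; rewrite invr1 !mul1r -mulr2n -[_ *+ 2]mulr_natr mulfK ?pnatr_eq0.
Qed.

Variables (phi : 'I_K.+1 -> 'cV[C]_n) (ks : {ffun 'I_T -> 'I_K.+1}).
Variables (U G V : 'M[C]_n).
Hypothesis phi1 : forall k, adj (phi k) *m phi k = 1%:M.
Hypothesis UU : adj U *m U = 1%:M.
Hypothesis VV : V *m adj V = 1%:M.
Local Notation P := (ketbra (phi ord0)).
Local Notation Q := (coproj (phi ord0)).
Let rho := G *m adj G.
Hypothesis rho1 : \tr rho = 1.
Let W : JOp := gates ks phi (index_enum 'I_T).
Let X : 'M[C]_(#|{: JI}|, n) := init_gram T G.
Let X1 : JOp := conjby W (init_state T rho).
Let Wout : JOp := sysJ U *m adj W *m sysJ (adj U).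
Let p : C := \tr (survive phi ks (index_enum 'I_T) (Q *m rho *m Q)).

Let WW : adj W *m W = 1%:M. Proof. exact: gates_unitary. Qed.

Let hQ : adj Q = Q. Proof. exact: adj_coproj. Qed.

Let QQ : Q *m Q = Q. Proof. by apply: coproj_idem. Qed.

Let X1E : X1 = (W *m X) *m adj (W *m X).
Proof. by rewrite /X1 /rho init_gramE conjby_gram. Qed.

Let X1_herm : adj X1 = X1.
Proof. by rewrite X1E adjM adjK. Qed.

Let init_herm : adj (init_state T rho) = init_state T rho.
Proof. by rewrite /rho init_gramE adjM adjK. Qed.

Let X1_minus : X1 *m minus_proj None = X1.
Proof.
have := @gates_comm R n T K phi ks (index_enum 'I_T)
  (fun c c' => minus_amp R c * minus_amp R c').
rewrite -/W -/(minus_proj None) => Wm.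
have mX : minus_proj None *m X1 = X1.
  rewrite /X1 /conjby; have := @minus_proj_init R n T None rho.
  move: (init_state T rho) (minus_proj None) Wm => X0 m Wm mX0.
  by rewrite !mulmxA -Wm -(mulmxA W m) mX0.
by have := congr1 (@adj R _ _) mX; rewrite adjM adj_minus_proj X1_herm.
Qed.

Let pE : \tr (sysJ Q *m X1) = p.
Proof.
rewrite /X1 /conjby /W (@gates_survive R n T K phi ks phi1 _ _ (index_enum_uniq _) init_herm).
  by rewrite trace_qubits_init.
by move=> t _; exact: minus_proj_init.
Qed.

(** [p] is the weight of [Q] in a state of trace 1, and the weight of [P] is nonnegative. *)
Lemma survive_le1 : p <= 1.
Proof.
have P1 := phi1 ord0.
have trX1 : \tr X1 = 1.
  by rewrite tr_conjby// -tr_trace_qubits trace_qubits_init.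
have P0 : 0 <= \tr (sysJ P *m X1).
  rewrite -tr_conj_coproj ?adj_ketbra ?ketbra_idem// X1E conjby_gram.
  exact: tr_mul_adj_ge0.
rewrite -pE /coproj sysJB sysJ1; move: P0 trX1; move: (sysJ P) X1 => q x P0 tx.
by rewrite mulmxBl mul1mx raddfB /= tx gerBl.
Qed.

(** Makes the error Hermitian, as [trnorm_hermitian] requires. *)
Lemma adj_procedure_run :
  adj (procedure_run phi (fun k => U *m phi k) ord0 ks rho) =
  procedure_run phi (fun k => U *m phi k) ord0 ks rho.
Proof.
have adj_conjby (A Y : JOp) : adj Y = Y -> adj (conjby A Y) = conjby A Y.
  by move=> hY; rewrite /conjby !adjM adjK hY mulmxA.
rewrite (procedure_runE ks G phi1 UU) -/W -/rho -/X1 -/Wout adjD.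
congr (_ + _); rewrite adj_trace_qubits; congr trace_qubits.
  by rewrite !adj_conjby.
rewrite (adj_conjby Wout)// replace_sysE adj_sum; apply: eq_bigr => j _.
exact: (adj_conjby _ _ (adj_conjby (sysJ Q *m prep None true) _ X1_herm)).
Qed.

(** What follows the projection on [Q] preserves the trace, and a unitary test of a positive
    operator is at most its trace. *)
Lemma fail_branch_le :
  `|\tr (V *m trace_qubits (conjby Wout (replace_sys (U *m phi ord0)
     (conjby (sysJ Q *m prep None true) X1))))| <= p.
Proof.
pose Z := conjby (sysJ Q *m prep None true) X1.
have trZ : \tr Z = p.
  rewrite /Z -conjby_mul tr_conj_coproj// -tr_trace_qubits trace_qubits_sysJl.
  by rewrite trace_qubits_conj_prep// -trace_qubits_sysJl tr_trace_qubits.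
have Wout1 : adj Wout *m Wout = 1%:M.
  rewrite /Wout; have := @sysJK R n T U UU.
  have : sysJ U *m sysJ (adj U) = 1%:M :> JOp by rewrite sysJ_mul (mulmx1C UU) sysJ1.
  have := adj_sysJ T U; have := adj_sysJ T (adj U); rewrite adjK.
  move: (sysJ U) (sysJ (adj U)) W WW => u u' w ww h' h uu' uk.
  by rewrite !adjM adjK h h' -!mulmxA uk (mulmxA w) (mulmx1C ww) mul1mx uu'.
have v1 : adj (U *m phi ord0) *m (U *m phi ord0) = 1%:M.
  by rewrite adjM -mulmxA (mulmxA (adj U)) UU mul1mx.
rewrite -trZ -(tr_replace_sys _ v1) -(tr_conjby _ Wout1) -/Z replace_sysE.
have -> : \sum_j sysJ (U *m phi ord0 *m delta_mx 0 j) *m Z *m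
      adj (sysJ (U *m phi ord0 *m delta_mx 0 j)) =
    \sum_j conjby (sysJ (U *m phi ord0 *m delta_mx 0 j)) Z by [].
rewrite conjby_sum trace_qubits_sum mulmx_sumr !raddf_sum /=.
apply: le_trans (ler_norm_sum _ _ _) _; apply: ler_sum => j _.
rewrite /Z X1E !conjby_gram.
exact: tr_sys_gram_le.
Qed.

(** The success branch replaces the factor [X] by [X - E], where [E] has squared norm [p]. The cross
    terms cost [dl + p / dl], the square of [E] costs [p], and the failing branch costs [p]
    again. *)
Lemma run_distance_le (dl : C) : 0 < dl ->
  `|\tr (V *m (U *m rho *m adj U -
               procedure_run phi (fun k => U *m phi k) ord0 ks rho))|
    <= dl + p / dl + 2 * p.
Proof.
move=> dl0; rewrite (procedure_runE ks G phi1 UU) -/W -/rho -/X1 -/Wout.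
rewrite (success_branchE ks G phi1 UU) -/W -/X opprD addrA -mulmxBl -mulmxBr.
set Y := adj W *m sysJ P *m W *m X.
pose E := adj W *m (sysJ Q *m (W *m X)).
have YE : Y = X - E.
  have sP : sysJ P = 1%:M - sysJ Q :> JOp.
    by rewrite -sysJ1 -sysJB /coproj subKr.
  rewrite /Y /E sP; move: (sysJ Q) X => q x.
  by rewrite mulmxBr mulmx1 !mulmxBl WW mul1mx !mulmxA.
have EE : \tr (E *m adj E) = p.
  rewrite /E -conjby_gram tr_conjby ?adjK ?(mulmx1C WW)//.
  by rewrite -conjby_gram -X1E tr_conj_coproj.
have XX : \tr (X *m adj X) = 1.
  by rewrite -init_gramE -tr_trace_qubits trace_qubits_init.
have -> : rho - trace_qubits (Y *m adj Y) =
    trace_qubits (X *m adj E) + trace_qubits (E *m adj X) - trace_qubits (E *m adj E).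
  have <- : trace_qubits (X *m adj X) = rho by rewrite -init_gramE trace_qubits_init.
  by rewrite -(trace_qubitsB (X *m adj X)) YE gram_sub trace_qubitsB trace_qubitsD.
have V'V : (adj U *m V *m U) *m adj (adj U *m V *m U) = 1%:M.
  rewrite !adjM adjK -!mulmxA (mulmxA U) (mulmx1C UU) mul1mx.
  by rewrite (mulmxA V) VV mul1mx UU.
rewrite mulmxBr raddfB /=; apply: le_trans (ler_normB _ _) _.
have trV (A : 'M[C]_n) : \tr (V *m (U *m A *m adj U)) = \tr (adj U *m V *m U *m A).
  by rewrite !mulmxA mxtrace_mulC !mulmxA.
rewrite trV mulmxBr mulmxDr raddfB raddfD /=.
rewrite mulrDl mul1r addrA.
apply: lerD fail_branch_le.
apply: le_trans (ler_normB _ _) _; apply: lerD.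
  apply: le_trans (ler_normD _ _) _.
  have dl'0 : 0 < dl^-1 by rewrite invr_gt0.
  (* Inverse weights put [dl] on [X], of norm 1, and [dl^-1] on [E] in both cross terms. *)
  have := lerD (@tr_sys_mul_adj_le R n T _ _ X E _ V'V dl'0)
               (@tr_sys_mul_adj_le R n T _ _ E X _ V'V dl0).
  rewrite EE XX invrK => /le_trans; apply.
  have -> : (dl^-1 * p + dl * 1) / 2 + (dl * 1 + dl^-1 * p) / 2 = dl + p / dl.
    by move: p => q; field; rewrite gt_eqF.
  by [].
by rewrite -EE; exact: tr_sys_gram_le.
Qed.

End RunDistance.

(** * Transfer between the ambient space and the input subspace *)

Section InputSpace.
Variables (R : realType) (n d K : nat) (phi : 'I_K.+1 -> 'cV[R[i]]_n).
Variable V : 'M[R[i]]_(n, d).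
Local Notation C := R[i].
Hypothesis VV : adj V *m V = 1%:M.

(** The transposes express a condition on columns: those of [A] lie in the range of [V], where
    [V *m adj V] is the identity. *)
Lemma row_space_proj m (A : 'M[C]_(n, m)) : (A^T <= V^T)%MS -> V *m (adj V *m A) = A.
Proof.
case/submxP => D /(congr1 trmx); rewrite trmxK trmx_mul trmxK => ->.
by rewrite (mulmxA (adj V)) VV mul1mx.
Qed.

Lemma Hin_phi k : ((phi k)^T <= Hin phi)%MS.
Proof. by rewrite (sumsmx_sup k)// genmxE. Qed.

Hypothesis phi1 : forall k, adj (phi k) *m phi k = 1%:M.
Hypothesis phiV : forall k, V *m (adj V *m phi k) = phi k.
Let psi k := adj V *m phi k.

Lemma restrict_unit k : adj (psi k) *m psi k = 1%:M.
Proof. by rewrite /psi adjM adjK -mulmxA phiV phi1. Qed.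

Lemma ketbra_restrict k : ketbra (phi k) *m V = V *m ketbra (psi k).
Proof. by rewrite /ketbra /psi adjM adjK !mulmxA -(mulmxA V) phiV. Qed.

Lemma refl_restrict k : refl (phi k) *m V = V *m refl (psi k).
Proof.
by rewrite /refl mulmxBl mulmxBr mul1mx mulmx1 -scalemxAl -scalemxAr ketbra_restrict.
Qed.

Lemma coproj_restrict k : coproj (phi k) *m V = V *m coproj (psi k).
Proof. by rewrite /coproj mulmxBl mulmxBr mul1mx mulmx1 ketbra_restrict. Qed.

(** The vectors [phi k] lie in the range of [V], so [V] intertwines the reflections of both
    spaces. *)
Lemma Dmap_restrict Y : adj V *m Dmap phi (V *m Y *m adj V) *m V = Dmap psi Y.
Proof.
rewrite /Dmap -scalemxAr -scalemxAl; congr (_ *: _).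
rewrite mulmx_sumr mulmx_suml; apply: eq_bigr => k _.
have rV : adj V *m refl (phi k) = refl (psi k) *m adj V.
  by rewrite -[LHS]adjK adjM adjK adj_refl refl_restrict adjM adj_refl.
rewrite !mulmxA rV -!mulmxA refl_restrict (mulmxA (adj V) V) VV mul1mx.
by rewrite (mulmxA (adj V) V) VV mul1mx.
Qed.

Lemma row_lin_mx (f : 'M[C]_d -> 'M[C]_d) i :
  row i (lin_mx f) = mxvec (f (vec_mx (delta_mx 0 i))).
Proof. by apply/rowP => j; rewrite !mxE. Qed.

(** The map inside [Dmatrix] is a bare function, so its matrix is compared row by row with the
    average of the linear maps [B k]. *)
Lemma mul_Dmatrix Y : mxvec Y *m Dmatrix phi V = mxvec (Dmap psi Y).
Proof.
pose B k : 'M[C]_(d * d) := lin_mx (mulmxr (refl (psi k)) \o mulmx (refl (psi k))).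
have sumB Z : mxvec Z *m (K.+1%:R^-1 *: \sum_k B k) = mxvec (Dmap psi Z).
  rewrite -scalemxAr mulmx_sumr /Dmap linearZ /=; congr (_ *: _); rewrite linear_sum.
  by apply: eq_bigr => k _; rewrite mul_vec_lin.
have -> : Dmatrix phi V = K.+1%:R^-1 *: \sum_k B k; last exact: sumB.
apply/row_matrixP => i; rewrite row_lin_mx Dmap_restrict -sumB vec_mxK.
by rewrite rowE.
Qed.

Lemma survive_restrict T (ks : 'I_T -> 'I_K.+1) r Y :
  survive phi ks r (V *m Y *m adj V) = V *m survive psi ks r Y *m adj V.
Proof.
elim: r Y => [//|t r IH] Y /=; rewrite -IH; congr survive; rewrite /survive_step.
have rV : adj V *m refl (phi (ks t)) = refl (psi (ks t)) *m adj V.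
  by rewrite -[LHS]adjK adjM adjK adj_refl refl_restrict adjM adj_refl.
have qV : adj V *m coproj (phi ord0) = coproj (psi ord0) *m adj V.
  by rewrite -[LHS]adjK adjM adjK adj_coproj coproj_restrict adjM adj_coproj.
rewrite !mulmxA -(mulmxA _ _ V) refl_restrict mulmxA coproj_restrict.
by rewrite -!mulmxA (mulmxA (adj V)) rV -!mulmxA qV !mulmxA.
Qed.

Lemma tr_restrict Y : \tr (V *m Y *m adj V) = \tr Y.
Proof. by rewrite mxtrace_mulC mulmxA VV mul1mx. Qed.

End InputSpace.

(** * Purity, the choice of [T], and the final numerical bound *)

Section Average.
Variable R : realType.
Local Notation C := R[i].

(** Cauchy-Schwarz on each entry of the Gram matrix. For a state it says that the purity is at most
    1. *)
Lemma tr_gram_sqr_le m k (A : 'M[C]_(m, k)) :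
  \tr (A *m adj A *m adj (A *m adj A)) <= \tr (A *m adj A) ^+ 2.
Proof.
pose r i : 'rV[C]_k := row i A.
have gE i j : (A *m adj A) i j = (r i *m adj (r j)) 0 0.
  by rewrite mulmx_adjE mxE; apply: eq_bigr => l _; rewrite adjE !mxE.
rewrite tr_mul_adj expr2 /mxtrace mulr_suml; apply: ler_sum => i _.
rewrite mulr_sumr; apply: ler_sum => j _; rewrite -normCK !gE.
exact: cauchy_schwarz.
Qed.

(* [T] makes [(1 - (1 - s) / d) ^ T <= exp (- (1 - s) T / d)] at most [eps^2 / (8 d)]. *)
Lemma geometric_decay (d T : nat) (s eps : R) : (0 < d)%N -> 0 < eps -> s < 1 ->
  0 <= 1 - (1 - s) / d%:R ->
  d%:R * ln (8 * eps ^- 2 * d%:R) / (1 - s) <= T%:R ->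
  (1 - (1 - s) / d%:R) ^+ T * (d%:R / 2) <= eps ^+ 2 / 16.
Proof.
move=> d0 e0 s1 mu0 hT.
have d0' : 0 < d%:R :> R by rewrite ltr0n.
have c0 : 0 < 8 * eps ^- 2 * d%:R.
  by rewrite !mulr_gt0// invr_gt0 exprn_gt0.
pose x := (1 - s) / d%:R.
have pow_le : (1 - x) ^+ T <= sequences.expR (- (T%:R * x)).
  apply: (@le_trans _ _ (sequences.expR (- x) ^+ T)).
    by rewrite lerXn2r ?nnegrE ?expR_ge0// expR_ge1Dx.
  by rewrite -expRM_natl mulrN.
have exp_le : sequences.expR (- (T%:R * x)) <= (8 * eps ^- 2 * d%:R)^-1.
  rewrite expRN lef_pV2 ?posrE ?expR_gt0// -[X in X <= _](lnK (x := 8 * eps ^- 2 * d%:R)) ?posrE//.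
  rewrite ler_expR; move: hT; rewrite ler_pdivrMr ?subr_gt0//.
  by rewrite /x mulrA ler_pdivlMr// mulrC.
have := ler_wpM2r (_ : 0 <= d%:R / 2) (le_trans pow_le exp_le).
rewrite divr_ge0 ?ler0n// => /(_ isT) /le_trans; apply.
rewrite le_eqVlt; apply/orP; left; apply/eqP; field.
by rewrite !gt_eqF.
Qed.

End Average.

(** The weight [eps / 4] balances the first two terms. For [eps <= 4] the decay bound gives at most
    eps/4 + eps/4 + eps^2/8; beyond 4 that exceeds [eps], and [q <= 1] takes over. *)
Lemma average_bound (R : realType) (eps : R) (q : R[i]) : 0 < eps -> q <= 1 ->
  q <= (eps ^+ 2 / 16)%:C ->
  (eps / 4)%:C + q / (eps / 4)%:C + 2 * q <= eps%:C.
Proof.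
move=> e0 q1 q2; have e4 : 0 < eps / 4 by rewrite divr_gt0.
pose b := if eps <= 4 then eps ^+ 2 / 16 else 1.
have qb : q <= b%:C by rewrite /b; case: ifP.
have morphE (t c : R) : (t + c / t + 2 * c)%:C = t%:C + c%:C / t%:C + 2 * c%:C.
  by rewrite !rmorphD !rmorphM fmorphV rmorph_nat.
apply: (@le_trans _ _ (eps / 4 + b / (eps / 4) + 2 * b)%:C).
  rewrite morphE; apply: lerD; last by rewrite ler_wpM2l.
  by rewrite lerD2l ler_wpM2r// invr_ge0 ler0c ltW.
rewrite lecR /b; case: ifP => [le4|/negbT]; last rewrite -ltNge => gt4.
  have -> : eps ^+ 2 / 16 / (eps / 4) = eps / 4 by field; rewrite gt_eqF.
  by nra.
have -> : 1 / (eps / 4) = 4 / eps by field; rewrite gt_eqF.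
have : 4 / eps <= 1 by rewrite ler_pdivrMr// mul1r ltW.
by lra.
Qed.

(** * Averaging the runs and bounding the trace norm *)

Unset Implicit Arguments.

Theorem theorem2 (R : realType) (n d K T : nat) (U : 'M[R[i]]_n)
    (phin : 'I_K.+1 -> 'cV[R[i]]_n) (V : 'M[R[i]]_(n, d)) (eps : R) :
  adj U *m U = 1%:M ->
  (forall k, adj (phin k) *m phin k = 1%:M) ->
  adj V *m V = 1%:M ->
  (V^T == Hin phin)%MS ->
  (forall X : 'M[R[i]]_n, supported_on (Hin phin) X ->
     exists (m : nat) (c : 'I_m -> R[i]) (w : 'I_m -> seq 'I_K.+1),
       (forall j, w j != [::]) /\
       X = \sum_(j < m) c j *: \prod_(k <- w j) ketbra (phin k)) ->
  0 < eps ->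
  second_mag (Dmatrix phin V) < 1 ->
  d%:R * ln (8 * eps ^- 2 * d%:R) / (1 - second_mag (Dmatrix phin V)) <= T%:R ->
  forall rho : 'M[R[i]]_n, is_state rho -> (rho^T <= Hin phin)%MS ->
    trnorm (U *m rho *m adj U
            - channel_E T phin (fun k => U *m phin k) ord0 rho) <= eps%:C.
Proof.
move=> UU phi1 VV /eqmxP eqV _ e0 s1 hT rho [rho_psd rho1] rho_in.
have phiV k : V *m (adj V *m phin k) = phin k.
  by apply: row_space_proj => //; rewrite eqV Hin_phi.
have rhoV : V *m (adj V *m rho) = rho by apply: row_space_proj => //; rewrite eqV.
have [G rhoE] := psd_gram rho_psd.
pose psi k := adj V *m phin k.
have psi1 k : adj (psi k) *m psi k = 1%:M by exact: restrict_unit.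
have hM := mul_Dmatrix VV phiV.
pose run := @procedure_run R n T K.+1 phin (fun k => U *m phin k) ord0.
pose p (ks : {ffun 'I_T -> 'I_K.+1}) := \tr (survive phin ks (index_enum 'I_T)
  (coproj (phin ord0) *m rho *m coproj (phin ord0))).
pose N : R[i] := (K.+1 ^ T)%:R.
have N0 : 0 < N by rewrite ltr0n expn_gt0.
have avg1 (c : R[i]) : N^-1 * \sum_(ks : {ffun 'I_T -> 'I_K.+1}) c = c.
  rewrite sumr_const card_ffun !card_ord -[c *+ _]mulr_natl mulrA mulVf ?mul1r//.
  by rewrite gt_eqF.
pose q := N^-1 * \sum_ks p ks.
have q_le1 : q <= 1.
  rewrite -[X in _ <= X](avg1 1); apply: ler_wpM2l; first by rewrite invr_ge0 ltW.
  apply: ler_sum => ks _.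
  by rewrite /p rhoE; apply: survive_le1; rewrite -?rhoE.
(* The support hypothesis concerns the columns of [rho]; Hermitian symmetry gives the rows. *)
have rho_sub : rho = V *m (adj V *m rho *m V) *m adj V.
  have : adj (V *m (adj V *m rho)) = adj rho by rewrite rhoV.
  have hr : adj rho = rho by rewrite rhoE adjM adjK.
  by rewrite !adjM adjK hr => e; rewrite !mulmxA -(mulmxA V) rhoV e.
have q_le : q <= (eps ^+ 2 / 16)%:C.
  pose rho' := adj V *m rho *m V.
  have pE ks : p ks = \tr (survive psi ks (index_enum 'I_T)
      (coproj (psi ord0) *m rho' *m coproj (psi ord0))).
    rewrite /p -(tr_restrict VV) -(survive_restrict phiV); congr (\tr (survive _ _ _ _)).
    have qV : adj V *m coproj (phin ord0) = coproj (psi ord0) *m adj V.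
      by rewrite -[LHS]adjK adjM adjK adj_coproj (coproj_restrict phiV) adjM adj_coproj.
    rewrite [in LHS]rho_sub !mulmxA (coproj_restrict phiV) -!mulmxA qV.
    by rewrite !mulmxA.
  have rho'1 : \tr (rho' *m adj rho') <= 1.
    have -> : rho' = (adj V *m G) *m adj (adj V *m G).
      by rewrite /rho' rhoE adjM adjK !mulmxA.
    apply: le_trans (tr_gram_sqr_le _) _.
    have -> : \tr (adj V *m G *m adj (adj V *m G)) = 1; last by rewrite expr1n.
    rewrite adjM adjK mulmxA -(mulmxA (adj V)) -rhoE -/rho'.
    by rewrite -(tr_restrict VV) -rho_sub.
  have := survive_avg_le psi1 hM s1 T rho'1.
  under eq_bigr do rewrite -pE.
  rewrite -/N -/q => bound.
  (* [q <= 1] already says that [q] is real, hence at most its modulus. *)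
  apply: le_trans (real_ler_norm _) _; first by rewrite (ler_real q_le1) real1.
  apply: le_trans bound _.
  have := survive_rate_ge0 psi1 hM.
  set s := second_mag _; have -> : 1 - (1 - s%:C) / d%:R = (1 - (1 - s) / d%:R)%:C.
    by rewrite !rmorphB rmorphM rmorphB /= fmorphV rmorph_nat.
  rewrite ler0c => mu0.
  have := geometric_decay (unit_dim (psi1 ord0)) e0 s1 mu0 hT.
  rewrite -lecR; set x := 1 - _; suff -> : (x ^+ T * (d%:R / 2))%:C = x%:C ^+ T * (d%:R / 2) by [].
  by rewrite rmorphM rmorphXn rmorphM fmorphV !rmorph_nat.
have chE : U *m rho *m adj U - channel_E T phin (fun k => U *m phin k) ord0 rho =
    N^-1 *: \sum_(ks : {ffun 'I_T -> 'I_K.+1}) (U *m rho *m adj U - run ks rho).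
  rewrite sumrB scalerBr sumr_const card_ffun !card_ord -scaler_nat scalerA mulVf ?scale1r//.
  by rewrite gt_eqF.
rewrite chE; set D := _ *: _.
have hD : adj D = D.
  rewrite /D adj_scale fmorphV rmorph_nat adj_sum; congr (_ *: _).
  apply: eq_bigr => ks _; rewrite adjB /run rhoE adj_procedure_run//.
  by rewrite !adjM !adjK !mulmxA.
(* [W] depends on the averaged error only, so the same unitary tests every run. *)
have [W WW ->] := trnorm_hermitian hD.
have dl0 : 0 < (eps / 4)%:C by rewrite (ltcR 0) divr_gt0.
apply: le_trans (average_bound e0 q_le1 q_le).
rewrite /D -scalemxAr mxtraceZ mulmx_sumr raddf_sum normrM [`|N^-1|]ger0_norm; last by rewrite invr_ge0 ltW.
(* The bound for one run is affine in [p ks], so its average depends on [q] alone. *)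
have -> : (eps / 4)%:C + q / (eps / 4)%:C + 2 * q =
    N^-1 * \sum_ks ((eps / 4)%:C + p ks / (eps / 4)%:C + 2 * p ks).
  rewrite !big_split /= -mulr_suml -mulr_sumr !mulrDr avg1.
  by congr (_ + _ + _); [rewrite mulrA | rewrite mulrCA].
apply: ler_wpM2l; first by rewrite invr_ge0 ltW.
apply: le_trans (ler_norm_sum _ _ _) _.
apply: ler_sum => ks _; rewrite /p /run rhoE.
by apply: run_distance_le => //; rewrite -rhoE.
Qed.
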